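(* Let $n\ge2$ and let $\lambda$ be a partition. Then \[\mathrm{VST}^n(\lambda)\cong\bigoplus_{\mu\subseteq\lambda}B(\mu)^{\oplus V_\lambda^\mu},\] where $V^\mu_\lambda$ is the number of highest weight elements of weight $\mu$ in $\mathrm{VST}^n(\lambda)$. Moreover, \[\overline{g}_\lambda(\mathbf x;\alpha)=\sum_{\mu\subseteq\lambda}\alpha^{|\lambda|-|\mu|}V^\mu_\lambda\, s_\mu(\mathbf x).\]
   Context: A valued-set tableau of shape $\lambda$ with entries at most $n$ is a semistandard Young tableau of shape $\lambda$ (English convention) with entries in $\{1,\dots,n\}$, together with a division of each row into groups, each group a set of horizontally consecutive boxes of one row containing the same entry (equivalently, vertical dividers between some pairs of adjacent equal entries). The buoy of a group is its leftmost box, the anchor its rightmost box. $\mathrm{VST}^n(\lambda)$ is the set of these ($\mathrm{VST}^\infty(\lambda)$ allows all positive integers). $\mathrm{wt}(V)=\prod_jx_j^{m_j}$, $m_j$ the number of groups with entry $j$; weights are identified with sequences $(m_1,m_2,\dots)$; $|V|$ is the number of groups. The dual weak symmetric Grothendieck function is $\overline{g}_\lambda(\mathbf x;\alpha)=\sum_{V\in\mathrm{VST}^\infty(\lambda)}\alpha^{|\lambda|-|V|}\mathrm{wt}(V)$. Reading word: $\mathrm{rd}(V)$ reads only the buoy entries, columns from left to right, each column from bottom to top. Crystal operators: for $i\in\{1,\dots,n-1\}$, write $+$ for each letter $i$, $-$ for each $i+1$ of $\mathrm{rd}(V)$, cancel pairs $-+$ successively until $+\cdots+-\cdots-$ remains.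 $e_iV$: $0$ if no uncanceled $-$; else let $\mathsf g$ be the group of the leftmost uncanceled $-$; if the entry immediately above the anchor of $\mathsf g$ is $i$, move the divider between $\mathsf g$ and the group immediately to its left one step up (remove it, merging those groups, and insert a divider at the same horizontal position in the row above); otherwise change every $i+1$ of $\mathsf g$ to $i$. $f_iV$: $0$ if no uncanceled $+$; else let $\mathsf g$ be the group of the rightmost uncanceled $+$; if the entry immediately below the anchor of $\mathsf g$ is $i+1$, move the divider between $\mathsf g$ and the group to its left one step down (remove it and insert a divider at the same horizontal position in the row below); otherwise change every $i$ of $\mathsf g$ to $i+1$. Highest weight means $e_iV=0$ for all $i$. $B(\mu)$ is the $U_q(\mathfrak{sl}_n)$-highest weight crystal on semistandard tableaux of shape $\mu$ with entries in $\{1,\dots,n\}$; $\cong$ crystal isomorphism, $\bigoplus$ disjoint union, $B^{\oplus m}$ $m$ copies; $s_\mu$ Schur function.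
   Formalization: f_i tests for i+1 below the buoy of the group, not its anchor (the anchor rule can leave VST, e.g. 1|11 over 22); the expansion of g-bar is stated in x_1..x_n with V from VST^n, and in infinitely many variables with V from VST^N for N at least the length of λ (it fails for smaller N). *)

(* Defs.v *)
From HB Require Import structures.
From mathcomp Require Import all_boot all_order all_algebra finmap.
From mathcomp Require Import boolp classical_sets functions cardinality fsbigop.

Set Implicit Arguments.
Unset Strict Implicit.
Unset Printing Implicit Defensive.

Local Open Scope classical_set_scope.

(* Rows and columns are numbered from 0.  Letters are the positive integers;  *)
(* a weight (m_1, m_2, ...) is the function k |-> m_(k+1), so that a          *)
(* partition mu, seen as a weight, is nth 0 mu.                               *)

Definition is_partition (mu : seq nat) : bool :=
  sorted geq mu && (0 \notin mu).

Definition subpartitions (lam : seq nat) : set (seq nat) :=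
  [set mu | is_partition mu /\ forall r, nth 0 mu r <= nth 0 lam r].

Section Fillings.
Variable A : Type.

Definition cell (x0 : A) (T : seq (seq A)) (r c : nat) : A :=
  nth x0 (nth [::] T r) c.

Definition fill (sh : seq nat) (F : nat -> nat -> A) : seq (seq A) :=
  mkseq (fun r => mkseq (F r) (nth 0 sh r)) (size sh).

(* Boxes in the order: columns from left to right, each from bottom to top.   *)
Definition reading_order (sh : seq nat) : seq (nat * nat) :=
  [seq rc <- [seq (r, c) | c <- iota 0 (head 0 sh), r <- rev (iota 0 (size sh))]
     | rc.2 < nth 0 sh rc.1].

(* Cancellation of the pairs -+ in the word of letters of the boxes w, where  *)
(* + is the letter i and - is i.+1.  The result lists the boxes of the        *)
(* uncanceled + and those of the uncanceled -, both from right to left.       *)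
Definition signature (letter : A -> nat) (i : nat) (w : seq A) :
    seq A * seq A :=
  foldl (fun st x =>
    if letter x == i then
      if st.2 is _ :: ms then (st.1, ms) else (x :: st.1, st.2)
    else if letter x == i.+1 then (st.1, x :: st.2)
    else st) ([::], [::]) w.

Definition leftmost_minus (letter : A -> nat) (i : nat) (w : seq A) : option A :=
  ohead (rev (signature letter i w).2).

Definition rightmost_plus (letter : A -> nat) (i : nat) (w : seq A) : option A :=
  ohead (signature letter i w).1.

End Fillings.

(* Outside its shape a tableau has entry 0, which is not a letter.            *)
Notation entry := (cell 0).

(* An abstract crystal: the operators are defined on the ambient type elt,    *)
(* and None stands for 0.                                                     *)
Record crystal := Crystal {
  elt : Type;
  carrier : set elt;
  cwt : elt -> nat -> nat;
  ce : nat -> elt -> option elt;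
  cf : nat -> elt -> option elt }.

Definition intertwines (B C : crystal) (phi : elt B -> elt C)
    (opB : elt B -> option (elt B)) (opC : elt C -> option (elt C)) : Prop :=
  forall b, carrier b ->
    match opB b with
    | Some b' => carrier b' /\ opC (phi b) = Some (phi b')
    | None => opC (phi b) = None
    end.

(* The string lengths epsilon_i, phi_i are those given by iterating e_i, f_i, *)
(* so that they need not be mentioned.                                        *)
Definition crystal_iso (n : nat) (B C : crystal) : Prop :=
  exists phi : elt B -> elt C,
    [/\ set_bij (@carrier B) (@carrier C) phi,
        forall b, carrier b -> cwt (phi b) = cwt b &
        forall i, 0 < i < n ->
          intertwines phi (@ce B i) (@ce C i) /\
          intertwines phi (@cf B i) (@cf C i)].

Definition crystal_sum (I : Type) (P : set I) (B : I -> crystal) : crystal :=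
  {| elt := {i : I & elt (B i)};
     carrier := [set x | P (projT1 x) /\ carrier (projT2 x)];
     cwt := fun x => cwt (projT2 x);
     ce := fun i x => omap (existT _ (projT1 x)) (ce i (projT2 x));
     cf := fun i x => omap (existT _ (projT1 x)) (cf i (projT2 x)) |}.

Definition crystal_copies (m : nat) (B : crystal) : crystal :=
  crystal_sum [set k : nat | k < m] (fun=> B).

Definition is_ssyt (mu : seq nat) (T : seq (seq nat)) : Prop :=
  [/\ shape T = mu,
      forall r c, c < nth 0 mu r -> 0 < entry T r c,
      forall r c, c.+1 < nth 0 mu r -> entry T r c <= entry T r c.+1 &
      forall r c, c < nth 0 mu r.+1 -> entry T r c < entry T r.+1 c].

Definition entries_le (n : nat) (T : seq (seq nat)) : Prop :=
  forall r c, entry T r c <= n.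

Definition content (T : seq (seq nat)) (k : nat) : nat :=
  count (pred1 k.+1) (flatten T).

Definition ssyt_letter (T : seq (seq nat)) (rc : nat * nat) : nat :=
  entry T rc.1 rc.2.

Definition ssyt_set (T : seq (seq nat)) (r c x : nat) : seq (seq nat) :=
  fill (shape T) (fun r' c' =>
    if (r' == r) && (c' == c) then x else entry T r' c').

Definition ssyt_e (i : nat) (T : seq (seq nat)) : option (seq (seq nat)) :=
  omap (fun rc => ssyt_set T rc.1 rc.2 i)
    (leftmost_minus (ssyt_letter T) i (reading_order (shape T))).

Definition ssyt_f (i : nat) (T : seq (seq nat)) : option (seq (seq nat)) :=
  omap (fun rc => ssyt_set T rc.1 rc.2 i.+1)
    (rightmost_plus (ssyt_letter T) i (reading_order (shape T))).

Definition Bcrystal (n : nat) (mu : seq nat) : crystal :=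
  {| elt := seq (seq nat);
     carrier := [set T | is_ssyt mu T /\ entries_le n T];
     cwt := content;
     ce := ssyt_e;
     cf := ssyt_f |}.

(* A tableau V.1 with a division V.2 of its rows into groups: the flag of a   *)
(* box is true iff the box is the buoy of its group.  So a true flag in a     *)
(* column c > 0 is a group boundary on the left side of the box, and this     *)
(* boundary is forced between distinct entries.                               *)
Definition vtab : Type := (seq (seq nat) * seq (seq bool))%type.

Notation is_buoy V := (cell false (snd V)).

Definition is_vst (lam : seq nat) (V : vtab) : Prop :=
  [/\ is_ssyt lam V.1,
      shape V.2 = lam,
      forall r, 0 < nth 0 lam r -> is_buoy V r 0 &
      forall r c, c.+1 < nth 0 lam r ->
        entry V.1 r c != entry V.1 r c.+1 -> is_buoy V r c.+1].

Definition buoys (V : vtab) : seq (nat * nat) :=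
  [seq rc <- reading_order (shape V.1) | is_buoy V rc.1 rc.2].

Definition vst_letter (V : vtab) (rc : nat * nat) : nat := entry V.1 rc.1 rc.2.

Definition ngroups (V : vtab) : nat := size (buoys V).

Definition vst_wt (V : vtab) (k : nat) : nat :=
  count (fun rc => vst_letter V rc == k.+1) (buoys V).

(* Column of the anchor of the group whose buoy is (r, c).                    *)
Definition anchor (V : vtab) (r c : nat) : nat :=
  c + find id (drop c.+1 (nth [::] V.2 r)).

Definition recolor (V : vtab) (r c x : nat) : vtab :=
  (fill (shape V.1) (fun r' c' =>
     if (r' == r) && (c <= c' <= anchor V r c) then x else entry V.1 r' c'),
   V.2).

(* Moves the divider on the left of the box (r, c) to the row r2.             *)
Definition move_divider (V : vtab) (r r2 c : nat) : vtab :=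
  (V.1, fill (shape V.2) (fun r' c' =>
     if (r' == r) && (c' == c) then false
     else if (r' == r2) && (c' == c) then true
     else is_buoy V r' c')).

Definition vst_e (i : nat) (V : vtab) : option vtab :=
  omap (fun rc => let: (r, c) := rc in
      if (0 < r) && (entry V.1 r.-1 (anchor V r c) == i)
      then move_divider V r r.-1 c
      else recolor V r c i)
    (leftmost_minus (vst_letter V) i (buoys V)).

(* For f_i the entry i.+1 is looked for below the buoy, dually to e_i.  If it *)
(* occurs below the anchor, then it also occurs below the buoy.  If it occurs *)
(* below the buoy but not below the anchor, recoloring the group would break  *)
(* column strictness: e.g. f_1 on the groups 1|11 over 22.                    *)
Definition vst_f (i : nat) (V : vtab) : option vtab :=
  omap (fun rc => let: (r, c) := rc in
      if entry V.1 r.+1 c == i.+1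
      then move_divider V r r.+1 c
      else recolor V r c i.+1)
    (rightmost_plus (vst_letter V) i (buoys V)).

Definition VST (n : nat) (lam : seq nat) : crystal :=
  {| elt := vtab;
     carrier := [set V | is_vst lam V /\ entries_le n V.1];
     cwt := vst_wt;
     ce := vst_e;
     cf := vst_f |}.

Definition highest_weight (n : nat) (V : vtab) : Prop :=
  forall i, 0 < i < n -> vst_e i V = None.

Definition hw_elements (n : nat) (lam mu : seq nat) : set vtab :=
  [set V | [/\ is_vst lam V, entries_le n V.1, highest_weight n V &
               vst_wt V = nth 0 mu]].

Definition hw_mult (n : nat) (lam mu : seq nat) : nat :=
  #|` fset_set (hw_elements n lam mu)|%fset.

Local Open Scope ring_scope.

(* Formal power series in x_1, x_2, ... over Z[alpha], given by their         *)
(* coefficients: F m is the coefficient of prod_k x_(k+1)^(m k), and 'X       *)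
(* stands for alpha.                                                          *)
Definition series := (nat -> nat) -> {poly int}.

Definition gbar (lam : seq nat) : series := fun m =>
  \sum_(V \in [set V : vtab | is_vst lam V /\ vst_wt V = m])
    ('X^(sumn lam - ngroups V) : {poly int}).

Definition schur (mu : seq nat) : series := fun m =>
  \sum_(T \in [set T : seq (seq nat) | is_ssyt mu T /\ content T = m])
    (1 : {poly int}).

(* The index sets of the sums and cardinals above are finite, so that none of *)
(* them takes a default value.                                                *)

Local Open Scope nat_scope.

Lemma finite_bounded_seq (a b : nat) :
  finite_set [set s : seq nat | size s <= a /\ forall i, nth 0 s i <= b].
Proof.
apply: (@sub_finite_set _ _
  ((fun t : {bseq a of 'I_b.+1} => map val t) @` setT)); last first.
  exact/finite_image/finite_finset.
move=> s /= [sz bd].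
have szm : size (map (@inord b) s) <= a by rewrite size_map.
exists (Bseq szm) => //=; rewrite -map_comp -[RHS]map_id.
apply/eq_in_map => x xs /=; rewrite inordK // ltnS.
by rewrite -(nth_index 0 xs) bd.
Qed.

Lemma finite_seq_shape (A : choiceType) (X : set A) (sh : seq nat) :
  finite_set X ->
  finite_set [set T : seq (seq A) |
    shape T = sh /\ forall s x, s \in T -> x \in s -> X x].
Proof.
move=> finX.
have rows a : finite_set [set s : seq A | size s = a /\
    forall x, x \in s -> X x].
  elim: a => [|a IHa].
    apply: (@sub_finite_set _ _ [set [::]]); last exact: finite_set1.
    by move=> s /= [/size0nil -> _].
  apply: sub_finite_set (finite_image2 (fun x s => x :: s) finX IHa).
  move=> [|x s] /= [] // [sz] Xs; exists x; first by apply: Xs; rewrite mem_head.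
  by exists s => //; split=> // y ys; apply: Xs; rewrite in_cons ys orbT.
elim: sh => [|a sh IH].
  apply: (@sub_finite_set _ _ [set [::]]); last exact: finite_set1.
  by move=> [|s T] //= [].
apply: sub_finite_set (finite_image2 (fun x s => x :: s) (rows a) IH).
move=> [|s T] /= [] // [sz shT] Xs; exists s.
  by split=> // x; apply: Xs; rewrite mem_head.
exists T => //; split=> // t x tT; apply: Xs; by rewrite in_cons tT orbT.
Qed.

Lemma mem_entry (T : seq (seq nat)) (r c : nat) :
  c < nth 0 (shape T) r -> entry T r c \in flatten T.
Proof.
move=> cr; have rT : r < size T.
  by rewrite ltnNge; apply/negP => h; rewrite nth_default ?size_map in cr.
rewrite (nth_map [::]) // in cr.
by apply/flattenP; exists (nth [::] T r); apply: mem_nth.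
Qed.

Lemma entry_exists (T : seq (seq nat)) (x : nat) : x \in flatten T ->
  exists r c, c < nth 0 (shape T) r /\ entry T r c = x.
Proof.
case/flattenP => s sT xs; exists (index s T), (index x s).
have iT : index s T < size T by rewrite index_mem.
by rewrite (nth_map [::]) // /cell !nth_index // index_mem.
Qed.

Lemma finite_subpartitions (lam : seq nat) : finite_set (subpartitions lam).
Proof.
apply: sub_finite_set
  (finite_bounded_seq (size lam) (\max_(i < size lam) nth 0 lam i)).
move=> mu /= [/andP[_ mu0] le]; split.
  rewrite leqNgt; apply/negP => lt.
  have := le (size lam); rewrite (nth_default _ (leqnn _)) leqn0 => /eqP e.
  by move: mu0; rewrite -e mem_nth.
move=> i; apply: leq_trans (le i) _.
case: (ltnP i (size lam)) => h; last by rewrite nth_default.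
exact: (leq_bigmax (Ordinal h)).
Qed.

Lemma finite_ssyt (n : nat) (mu : seq nat) :
  finite_set [set T | is_ssyt mu T /\ entries_le n T].
Proof.
apply: sub_finite_set (finite_seq_shape mu (finite_II n.+1)).
move=> T /= [[shT _ _ _] le]; split=> // s x sT xs.
have /entry_exists[r [c [_ <-]]] : x \in flatten T.
  by apply/flattenP; exists s.
exact: le.
Qed.

Lemma finite_vst (n : nat) (lam : seq nat) :
  finite_set [set V | is_vst lam V /\ entries_le n V.1].
Proof.
have flags : finite_set [set: bool] by exact: finite_finset.
apply: sub_finite_set
  (finite_image2 pair (finite_ssyt n lam) (finite_seq_shape lam flags)).
by move=> [T D] /= [[ssT shD _ _] le]; exists T => //; exists D.
Qed.

Lemma finite_hw_elements (n : nat) (lam mu : seq nat) :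
  finite_set (hw_elements n lam mu).
Proof. by apply: sub_finite_set (finite_vst n lam) => V /= []. Qed.

Lemma entry_le_max (T : seq (seq nat)) (r c : nat) :
  entry T r c <= \max_(x <- flatten T) x.
Proof.
case: (ltnP c (nth 0 (shape T) r)) => [/mem_entry h|h].
  exact: (@leq_bigmax_seq _ _ xpredT id).
rewrite /cell; case: (ltnP r (size T)) => hr.
  by rewrite nth_default // -(nth_map _ 0).
by rewrite (nth_default [::] hr) nth_nil.
Qed.

Lemma finite_ssyt_content (mu : seq nat) (m : nat -> nat) :
  finite_set [set T | is_ssyt mu T /\ content T = m].
Proof.
have [->|/set0P[T0 /= [_ <-]]] := eqVneq [set T | is_ssyt mu T /\ content T = m] set0.
  exact: finite_set0.
apply: sub_finite_set (finite_ssyt (\max_(x <- flatten T0) x) mu).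
move=> T /= [ssT eqm]; split=> // r c.
have [h|h] := ltnP c (nth 0 (shape T) r); last first.
  rewrite /cell; case: (ltnP r (size T)) => hr.
    by rewrite nth_default // -(nth_map _ 0).
  by rewrite (nth_default [::] hr) nth_nil.
case E: (entry T r c) => [//|k].
have : 0 < content T0 k.
  by rewrite -eqm -has_count has_pred1 -E mem_entry.
rewrite -has_count has_pred1 => h0.
exact: (@leq_bigmax_seq _ _ xpredT id).
Qed.

Lemma partition_le_head (lam : seq nat) (r : nat) :
  is_partition lam -> nth 0 lam r <= head 0 lam.
Proof.
case: lam => [|a lam] /andP[srt _]; first by rewrite nth_nil.
case: r => [//|r] /=; case: (ltnP r (size lam)) => h; last by rewrite nth_default.
have tr : transitive geq by move=> y x z yx zy; exact: leq_trans zy yx.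
by have /allP/(_ _ (mem_nth 0 h)) := order_path_min tr srt.
Qed.

Lemma vst_wt_gt0 (lam : seq nat) (V : vtab) (r c k : nat) :
  is_partition lam -> is_vst lam V -> c < nth 0 lam r ->
  entry V.1 r c = k.+1 -> 0 < vst_wt V k.
Proof.
move=> plam [[sh1 _ _ _] sh2 b0 bS]; elim: c => [|c IHc] cr Ek.
  rewrite -has_count; apply/hasP; exists (r, 0); last by rewrite /vst_letter /= Ek.
  rewrite mem_filter b0 //= mem_filter sh1 cr /=; apply/allpairsPdep.
  exists 0, r; rewrite mem_iota mem_rev mem_iota /= add0n.
  rewrite (leq_trans cr (partition_le_head r plam)); split=> //.
  by rewrite ltnNge; apply/negP => h; rewrite nth_default in cr.
have [bc|nbc] := boolP (is_buoy V r c.+1).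
  rewrite -has_count; apply/hasP; exists (r, c.+1).
    rewrite mem_filter bc /= mem_filter sh1 cr /=; apply/allpairsPdep.
    exists c.+1, r; rewrite mem_iota mem_rev mem_iota /= !add0n.
    rewrite (leq_trans cr (partition_le_head r plam)); split=> //.
    by rewrite ltnNge; apply/negP => h; rewrite nth_default in cr.
  by rewrite /vst_letter /= Ek.
apply: IHc; first exact: ltnW.
rewrite -Ek; apply/eqP; apply: contraNT nbc; exact: bS.
Qed.

Lemma finite_vst_wt (lam : seq nat) (m : nat -> nat) : is_partition lam ->
  finite_set [set V | is_vst lam V /\ vst_wt V = m].
Proof.
move=> plam.
have [->|/set0P[V0 /= [_ <-]]] := eqVneq [set V | is_vst lam V /\ vst_wt V = m] set0.
  exact: finite_set0.
apply: sub_finite_set (finite_vst (\max_(x <- flatten V0.1) x) lam).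
move=> V /= [vV eqm]; split=> // r c.
have sh : shape V.1 = lam by case: vV => -[].
have [h|h] := ltnP c (nth 0 (shape V.1) r); last first.
  rewrite /cell; case: (ltnP r (size V.1)) => hr.
    by rewrite nth_default // -(nth_map _ 0).
  by rewrite (nth_default [::] hr) nth_nil.
case E: (entry V.1 r c) => [//|k].
rewrite sh in h; have := vst_wt_gt0 plam vV h E.
rewrite eqm -has_count => /hasP[[r0 c0] _ /eqP <-].
exact: entry_le_max.
Qed.

(* Main.v *)
Require Import Defs.
From mathcomp Require Import all_boot all_order all_algebra finmap zify.
From mathcomp Require Import boolp classical_sets functions cardinality fsbigop.

Set Implicit Arguments.
Unset Strict Implicit.
Unset Printing Implicit Defensive.

(** Reading the buoys sends VST^n(lam) to words, and e_i, f_i to the usual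
    operators on words: moving a divider does not move its letter in the reading
    word nor out of its column.  So the columns of the letters are constant on
    components, and together with the word they determine the tableau, each
    column being recovered greedily from its bottom.  On words, column insertion
    P commutes with the operators and the successive shapes Q are invariant;
    as (P, Q) is injective, a component is recovered from its highest weight
    element, and the highest weight words of weight mu all have the same P.
    A semistandard tableau is a valued-set tableau with all boxes buoys, hence
    V corresponds to the tableau T with P(T) = P(V), in the copy of B(mu)
    indexed by the highest weight element of its component.  In a highest weight
    element every entry of the r-th row is r, whence mu is contained in lam. *)

(** * Crystal operators on words *)

(** The site where e_i acts is encoded by a factorization of the word around one letter. As the
    cancellation of a concatenation is a product of pairs, comparing two numbers decides which
    factor e_i acts on. This reduces the commutation of P with the operators to a single column,
    from which it is carried to the next.

    The word alone does not determine the tableau: the one-row tableaux 1|11 and 11|1 both read 11.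
    Columns of buoys repair this because, unlike rows, they survive a divider move.

    Following operators down from highest weight elements would define an isomorphism only after
    proving that the result does not depend on the path. Equality of P is used instead as the
    definition: the operators respect it on both sides, and paths serve only to show that a partner
    exists.

    For the series, a monomial involves finitely many letters, so that a finite n suffices, and the
    multiplicities no longer depend on n once n reaches the length of lam. *)

(* (p, e) stands for the reduced word +^p -^e, so sgm is the product of the
   bicyclic monoid. *)
Definition sgm (p q : nat * nat) : nat * nat :=
  (p.1 + (q.1 - p.2), q.2 + (p.2 - q.1)).

Definition sgl (i x : nat) : nat * nat := (nat_of_bool (x == i), nat_of_bool (x == i.+1)).

Arguments sgm : simpl never.
Arguments sgl : simpl never.

Definition sg (i : nat) (w : seq nat) : nat * nat :=
  foldr (fun x => sgm (sgl i x)) (0, 0) w.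

Notation phi i w := (sg i w).1.
Notation eps i w := (sg i w).2.

Lemma sgmA : associative sgm.
Proof. by move=> [a b] [c d] [e f]; rewrite /sgm /=; congr pair; lia. Qed.

Lemma sgm0p p : sgm (0, 0) p = p.
Proof. by case: p => a b; rewrite /sgm /=; congr pair; lia. Qed.

Lemma sg_cat i u v : sg i (u ++ v) = sgm (sg i u) (sg i v).
Proof. by elim: u => [|x u /= ->]; rewrite /= ?sgm0p ?sgmA. Qed.

Lemma sg_neutral i w :
  all (fun x => (x != i) && (x != i.+1)) w -> sg i w = (0, 0).
Proof.
elim: w => //= x w IH /andP[/andP[/negbTE a /negbTE b] /IH ->].
by rewrite /sgl a b.
Qed.

(** Each cancellation removes one i and one i+1, so the difference of their numbers is that of the
    reduced word. *)
Lemma count_sg i w :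
  count (pred1 i) w + eps i w = count (pred1 i.+1) w + phi i w.
Proof.
elim: w => //= x w; rewrite /sgm /sgl /=; case: eqVneq => [->|_];
 case: eqVneq => [e|_] /=; lia.
Qed.

(* w' = e_i w: the same decomposition exhibits the leftmost uncanceled - of w and
   the rightmost uncanceled + of w'. *)
Definition estep (i : nat) (w w' : seq nat) : Prop :=
  exists u s, [/\ w = u ++ i.+1 :: s, w' = u ++ i :: s,
                  eps i u = 0 & phi i s = 0].

Lemma sgl_hi i : sgl i i.+1 = (0, 1).
Proof. by rewrite /sgl eqxx; case: eqVneq => // e; lia. Qed.

Lemma sgl_lo i : sgl i i = (1, 0).
Proof. by rewrite /sgl eqxx; case: eqVneq => // e; lia. Qed.

Lemma sg_hi i u s : eps i u = 0 -> phi i s = 0 ->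
  sg i (u ++ i.+1 :: s) = (phi i u, (eps i s).+1).
Proof.
move=> u0 s0; rewrite sg_cat /= sgl_hi /sgm /= u0 s0; congr pair; lia.
Qed.

Lemma sg_lo i u s : eps i u = 0 -> phi i s = 0 ->
  sg i (u ++ i :: s) = ((phi i u).+1, eps i s).
Proof.
move=> u0 s0; rewrite sg_cat /= sgl_lo /sgm /= u0 s0; congr pair; lia.
Qed.

Lemma sg_estep i w w' : estep i w w' ->
  phi i w' = (phi i w).+1 /\ eps i w = (eps i w').+1.
Proof.
by case=> u [s [-> -> u0 s0]]; rewrite sg_hi // sg_lo.
Qed.

Lemma estep_consP i x w z : estep i (x :: w) z <->
  [/\ x = i.+1, z = i :: w & phi i w = 0] \/
  exists w', [/\ z = x :: w', estep i w w' & (x == i.+1) <= phi i w].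
Proof.
split.
  case=> -[|y u] [s [/= [-> ->] -> u0 s0]]; first by left.
  right; exists (u ++ i :: s); split=> //.
    by exists u, s; split=> //; move: u0; rewrite /sgm /=; lia.
  move: u0; rewrite /sgm /sgl /= => u0.
  by rewrite sg_hi //=; lia.
case=> [[-> -> w0]|[w' [-> [u [s [-> -> u0 s0]]] le]]]; first by exists [::], w.
exists (x :: u), s; split=> //=.
move: le; rewrite sg_hi // /sgm /sgl /=; lia.
Qed.

(** The tensor product rule. The + left over in [t] cancel the rightmost - left over in [p], so the
    leftmost uncanceled - lies in [p] exactly when [p] has more of them than [t] has +. *)
Lemma estep_catP i p t z : estep i (p ++ t) z <->
  (exists p', [/\ z = p' ++ t, estep i p p' & phi i t < eps i p]) \/
  (exists t', [/\ z = p ++ t', estep i t t' & eps i p <= phi i t]).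
Proof.
elim: p z => [|x p IH] z.
  split=> [h|]; first by right; exists z.
  by case=> [[p' [_ _]]|[t' [-> h _]]]; rewrite ?ltn0.
rewrite cat_cons estep_consP; split.
  case=> [[-> -> h]|[w' [-> /IH [[p' [-> h1 h2]]|[t' [-> h1 h2]]] le]]].
  - left; exists (i :: p); split=> //.
      by apply/estep_consP; left; split=> //; move: h; rewrite sg_cat /sgm /=; lia.
    by move: h; rewrite sg_cat /= /sgm /sgl /=; lia.
  - left; exists (x :: p'); split=> //.
      apply/estep_consP; right; exists p'; split=> //.
      by move: le h2; rewrite sg_cat /sgm /=; lia.
    by rewrite /= /sgm /=; lia.
  right; exists t'; split=> //.
  by move: le h2; rewrite sg_cat /= /sgm /sgl /=; lia.
case=> [[p' [-> /estep_consP[[-> -> h]|[w' [-> h1 h2]]] lt]]|[t' [-> h le]]].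
- left; split=> //; move: lt; rewrite sg_cat /= /sgm /= /sgl.
  by move: h => /=; lia.
- right; exists (w' ++ t); split=> //.
    apply/IH; left; exists w'; split=> //.
    by have [] := sg_estep h1; move: h2 lt; rewrite /= /sgm /sgl /=; lia.
  by rewrite sg_cat /sgm /=; lia.
right; exists (p ++ t'); split=> //.
  apply/IH; right; exists t'; split=> //.
  by move: le; rewrite /= /sgm /=; lia.
by move: le; rewrite sg_cat /= /sgm /sgl /=; lia.
Qed.

Lemma estep_fun i w w1 w2 : estep i w w1 -> estep i w w2 -> w1 = w2.
Proof.
elim: w w1 w2 => [|x w IH] w1 w2; first by case=> -[|? ?] [? []].
case/estep_consP=> [[-> -> a]|[v1 [-> a a']]]; case/estep_consP=> [[e -> b]|[v2 [-> b b']]] //.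
- by have [h1 h2] := sg_estep b; move: b'; rewrite eqxx a.
- by have [h1 h2] := sg_estep a; move: a'; rewrite e eqxx b.
by rewrite (IH _ _ a b).
Qed.

Lemma estep_inj i w1 w2 w : estep i w1 w -> estep i w2 w -> w1 = w2.
Proof.
case=> u1 [s1 [-> -> a b]]; case=> u2 [s2 [-> + c d]].
elim: u1 u2 a c => [|x u1 IH] [|y u2] //= a c [].
- by move=> ->.
- by move=> <- e; move: b c; rewrite e sg_cat /= /sgm /sgl /=; lia.
- by move=> -> e; move: d a; rewrite -e sg_cat /= /sgm /sgl /=; lia.
move=> -> /IH ->//; first by move: a; rewrite /sgm /=; lia.
by move: c; rewrite /sgm /=; lia.
Qed.

Lemma eps0_later i u v : eps i (u ++ i.+1 :: v) = 0 -> i \in v.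
Proof.
rewrite sg_cat /= /sgm /sgl /= => h; apply/negPn/negP => niv.
have : phi i v = 0.
  have : count (pred1 i) v = 0 by apply/count_memPn.
  have := count_sg i v; lia.
lia.
Qed.

Lemma phi0_earlier i u v : phi i (u ++ i :: v) = 0 -> i.+1 \in u.
Proof.
rewrite sg_cat /= /sgm /sgl /= => h; apply/negPn/negP => niv.
have : count (pred1 i.+1) u = 0 by apply/count_memPn.
have := count_sg i u; lia.
Qed.

(** * The signature rule as a factorization of the word *)

Section Signature.
Variables (A : Type) (letter : A -> nat) (i : nat).
Notation sgA w := (sg i (map letter w)).

Lemma signature_rcons w y : signature letter i (rcons w y) =
  let st := signature letter i w in
  if letter y == i then
    if st.2 is _ :: ms then (st.1, ms) else (y :: st.1, st.2)
  else if letter y == i.+1 then (st.1, y :: st.2) else st.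
Proof. by rewrite /signature foldl_rcons. Qed.

Lemma sg_rcons w y : sgA (rcons w y) = sgm (sgA w) (sgl i (letter y)).
Proof. by rewrite map_rcons -cats1 sg_cat /= /sgm /=; congr pair; rewrite ?addn0 ?subn0; lia. Qed.

Lemma signature_size w :
  (size (signature letter i w).1, size (signature letter i w).2) = sgA w.
Proof.
elim/last_ind: w => // w y; rewrite sg_rcons signature_rcons.
case: (signature letter i w) => ps ms /= <-; rewrite /sgm /sgl /=.
case: eqVneq => [->|_]; last by case: eqVneq => _ /=; congr pair; lia.
by case: ms => [|m ms] /=; case: eqP => /=; move=> *; congr pair; lia.
Qed.

(** The site of e_i or of f_i, according to the letter of [x]: the factorization that [estep] asks
    for, kept at the level of boxes. *)
Definition isolated (x : A) (w : seq A) : Prop :=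
  exists u s, [/\ w = u ++ x :: s, eps i (map letter u) = 0
                & phi i (map letter s) = 0].

(** A new + has to be absorbed by a - of [s]; otherwise it would be uncanceled to the right of
    [x]. *)
Lemma isolated_rcons x y u s (w := u ++ x :: s) : (letter y = i -> 0 < eps i (map letter s)) ->
  eps i (map letter u) = 0 -> phi i (map letter s) = 0 -> isolated x (rcons w y).
Proof.
move=> h u0 s0; exists u, (rcons s y); split=> //; first by rewrite /w rcons_cat.
rewrite sg_rcons /sgm s0 /sgl /=; move: h; case: eqVneq => [-> /(_ erefl)|] /=; lia.
Qed.

Lemma signature_plus w x : ohead (signature letter i w).1 = Some x ->
  letter x = i /\ isolated x w.
Proof.
elim/last_ind: w => // w y IH; have := signature_size w.
rewrite signature_rcons; case: (signature letter i w) IH => ps ms /= IH sz.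
case: eqVneq => [yi|yni].
  case: ms sz => [|m ms] sz /=.
    case=> <-; split=> //; exists w, [::]; split=> //; first by rewrite cats1.
    by rewrite -sz.
  move=> /IH[xi [u [s [e u0 s0]]]]; split=> //; rewrite e; apply: isolated_rcons => // _.
  by move: sz; rewrite e map_cat /= xi sg_lo // => -[_ <-].
have -> : (if letter y == i.+1 then (ps, y :: ms) else (ps, ms)).1 = ps by case: ifP.
move=> /IH[xi [u [s [e u0 s0]]]]; split=> //; rewrite e; apply: isolated_rcons => // yi.
by rewrite yi eqxx in yni.
Qed.

Lemma signature_minus w x : ohead (rev (signature letter i w).2) = Some x ->
  letter x = i.+1 /\ isolated x w.
Proof.
have oh (B : Type) (m : B) s : ohead (rev (m :: s)) = if s is [::] then Some m else ohead (rev s).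
  by rewrite rev_cons; case/lastP: s => // s z; rewrite rev_rcons; case: s.
elim/last_ind: w => // w y IH; have := signature_size w.
rewrite signature_rcons; case: (signature letter i w) IH => ps ms /= IH sz.
case: eqVneq => [yi|yni].
  case: ms sz IH => [|m [|m' ms]] sz IH //= h.
  have /IH[xi [u [s [e u0 s0]]]] : ohead (rev [:: m, m' & ms]) = Some x by rewrite oh.
  split=> //; rewrite e; apply: isolated_rcons => // _.
  by move: sz; rewrite e map_cat /= xi sg_hi // => -[_ <-].
case: eqVneq => [yi|yni'] /=.
  rewrite oh; case: ms sz IH => [|m ms] sz IH.
    case=> <-; split=> //; exists w, [::]; split=> //; first by rewrite cats1.
    by rewrite -sz.
  move=> /IH[xi [u [s [e u0 s0]]]]; split=> //; rewrite e; apply: isolated_rcons => // yi'.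
  by rewrite yi' eqxx in yni.
move=> /IH[xi [u [s [e u0 s0]]]]; split=> //; rewrite e; apply: isolated_rcons => // yi.
by rewrite yi eqxx in yni.
Qed.

Lemma leftmost_minusP w :
  match leftmost_minus letter i w with
  | Some x => letter x = i.+1 /\ isolated x w
  | None => eps i (map letter w) = 0
  end.
Proof.
rewrite /leftmost_minus; case eh: (ohead _) => [x|]; first exact: signature_minus.
rewrite -signature_size /=; move: eh; case/lastP: (signature letter i w).2 => // s x.
by rewrite rev_rcons.
Qed.

Lemma rightmost_plusP w :
  match rightmost_plus letter i w with
  | Some x => letter x = i /\ isolated x w
  | None => phi i (map letter w) = 0
  end.
Proof.
rewrite /rightmost_plus; case eh: (ohead _) => [x|]; first exact: signature_plus.
by rewrite -signature_size /=; move: eh; case: (signature letter i w).1.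
Qed.

End Signature.

(** * Column insertion *)

Notation col C := (sorted ltn C).

(* Columns are listed from top to bottom.  The second component holds the letter
   bumped out, and is empty when x is placed at the bottom. *)
Fixpoint bump (x : nat) (C : seq nat) : seq nat * seq nat :=
  if C is c :: C' then
    if x <= c then (x :: C', [:: c])
    else let: (D, o) := bump x C' in (c :: D, o)
  else ([:: x], [::]).

Fixpoint ins (x : nat) (T : seq (seq nat)) : seq (seq nat) :=
  if T is C :: T' then
    let: (D, o) := bump x C in
    D :: (if o is y :: _ then ins y T' else T')
  else [:: [:: x]].

Definition colword (T : seq (seq nat)) : seq nat := flatten (map rev T).

Definition ptab (w : seq nat) : seq (seq nat) := foldr ins [::] w.

(* The successive shapes carry the information of the recording tableau. *)
Fixpoint qshapes (w : seq nat) : seq (seq nat) :=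
  if w is x :: w' then shape (ptab w) :: qshapes w' else [::].

Lemma bump_cat x A B : all (fun a => a < x) A ->
  bump x (A ++ B) = (A ++ (bump x B).1, (bump x B).2).
Proof.
elim: A => [|a A IH] /=; first by case: (bump x B).
by move=> /andP[ax /IH ->]; rewrite leqNgt ax.
Qed.

Variant bump_spec x C : seq nat * seq nat -> Prop :=
| BumpEnd of all (fun a => a < x) C : bump_spec x C (rcons C x, [::])
| BumpOut A y B of C = A ++ y :: B & all (fun a => a < x) A & x <= y :
    bump_spec x C (A ++ x :: B, [:: y]).

Lemma bumpP x C : bump_spec x C (bump x C).
Proof.
elim: C => [|c C IH] /=; first exact: BumpEnd.
case: leqP => xc; first exact: (@BumpOut x (c :: C) [::] c C).
case: IH => [h|A y B -> h xy].
  by rewrite -rcons_cons; apply: BumpEnd; rewrite /= xc.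
by apply: (@BumpOut _ _ (c :: A) y B) => //=; rewrite xc.
Qed.

Lemma col_mid A x B : col (A ++ x :: B) =
  [&& col A, col B, all (fun a => a < x) A, all (fun b => x < b) B & allrel ltn A B].
Proof.
have tr : transitive ltn by exact: ltn_trans.
rewrite !(sorted_pairwise tr) pairwise_cat /= allrel_consr.
move: (pairwise ltn A) (pairwise ltn B) (allrel ltn A B) => b1 b2 b3.
rewrite (eq_all (a2 := fun a => a < x)) // (eq_all (a1 := ltn x) (a2 := fun b => x < b)) //.
by case: b1; case: b2; case: b3; case: all; case: all.
Qed.

Lemma bump_col x C : col C -> col (bump x C).1.
Proof.
move=> cC; case: bumpP => [h|A y B eC h xy].
  by rewrite -cats1 col_mid cC h /= allrelC.
move: cC; rewrite eC !col_mid /= => /and5P[-> -> _ hB ->]; rewrite h andbT /=.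
by apply: sub_all hB => b /=; lia.
Qed.

Lemma ins_col x T : all (fun C => col C) T -> all (fun C => col C) (ins x T).
Proof.
elim: T x => //= C T IH x /andP[cC cT].
have := bump_col x cC; case: (bump x C) => D [|y o] /= -> //=; exact: IH.
Qed.

Lemma ptab_col w : all (fun C => col C) (ptab w).
Proof. by elim: w => //= x w; apply: ins_col. Qed.

Lemma perm_bump x C : perm_eq ((bump x C).1 ++ (bump x C).2) (x :: C).
Proof.
case: bumpP => [_|A y B -> _ _]; first by rewrite cats0 perm_rcons.
by apply/permP => p; rewrite /= !count_cat /=; lia.
Qed.

Lemma perm_ins x T : perm_eq (colword (ins x T)) (x :: colword T).
Proof.
rewrite /colword; elim: T x => //= C T IH x; have := perm_bump x C.
case: bumpP => [_|A y B _ _ _] /permP h; apply/permP => p; have := h p;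
  rewrite /= !(count_rev, count_cat) /=; first by lia.
by rewrite (permP (IH y)) /=; lia.
Qed.

Lemma perm_ptab w : perm_eq (colword (ptab w)) w.
Proof.
by elim: w => //= x w IH; rewrite (perm_trans (perm_ins x _)) // perm_cons.
Qed.

(** If [y] is bumped, [x] is at most [y] while all entries under [x] exceed [y]; so [x] is the
    lowest entry of the new column that is at most [y]. If nothing is bumped, [x] is at the
    bottom. *)
Lemma bump_inj x C x' C' : col C -> col C' -> size C = size C' ->
  bump x C = bump x' C' -> x = x' /\ C = C'.
Proof.
move=> cC cC' sz; case: bumpP => [h|A y B e h xy]; case: bumpP => [h'|A' y' B' e' h' xy'] //.
  by case=> /rcons_inj[-> ->].
case=> eq ey; rewrite -{}ey in e' xy' *; subst C C'.
have szA : size A = size A'.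
  move: cC cC'; rewrite !col_mid => /and5P[_ _ hA hB _] /and5P[_ _ hA' hB' _].
  have aux (U V U' V' : seq nat) (z z' : nat) : U ++ z :: V = U' ++ z' :: V' ->
      all (fun a => a < z') U' -> all (fun b => y < b) V ->
      z' <= y -> size U' <= size U.
    move=> eqU hU' hV z'y; rewrite leqNgt; apply/negP => lt.
    have := congr1 (nth 0 ^~ (size U')) eqU; rewrite !nth_cat ltnn subnn /= ltnNge ltnW //=.
    case Ek: (size U' - size U) => [|k] /=; first by lia.
    move=> hz; have : z' \in V.
      rewrite -hz mem_nth //; have := congr1 size eqU; rewrite !size_cat /=; lia.
    by move/(allP hV); rewrite ltnNge z'y.
  apply/eqP; rewrite eqn_leq; apply/andP; split.
    exact: (aux _ _ _ _ _ _ (esym eq)).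
  exact: (aux _ _ _ _ _ _ eq).
by move/eqP: eq; rewrite eqseq_cat // eqseq_cons => /and3P[/eqP-> /eqP-> /eqP->].
Qed.

(** The old and new heights of a column tell whether a letter was bumped out of it. Hence the
    insertion can be undone, from the last column reached back to the first. *)
Lemma ins_inj x T x' T' : all (fun C => col C) T -> all (fun C => col C) T' ->
  shape T = shape T' -> ins x T = ins x' T' -> x = x' /\ T = T'.
Proof.
elim: T T' x x' => [|C T IH] [|C' T'] x x' //=; first by move=> _ _ _ [->].
move=> /andP[cC cT] /andP[cC' cT'] [sz shT].
have := @bump_inj x C x' C' cC cC' sz.
have sb z K : size (bump z K).1 + size (bump z K).2 = (size K).+1.
  by rewrite -size_cat (perm_size (perm_bump z K)).
have := (sb x C, sb x' C').
case: (bumpP x C) => [h|A y B e h xy]; case: (bumpP x' C') => [h'|A' y' B' e' h' xy'];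
  rewrite /= => -[s1 s2] inj [] eD.
- by move=> ->; case: inj => [|-> ->] //; rewrite eD.
- by exfalso; move: s1 s2; rewrite eD; lia.
- by exfalso; move: s1 s2; rewrite eD; lia.
by case/(IH _ _ _ cT cT' shT) => ey ->; case: inj => [|-> ->] //; rewrite eD ey.
Qed.

Lemma pq_inj w w' : ptab w = ptab w' -> qshapes w = qshapes w' -> w = w'.
Proof.
elim: w w' => [|x w IH] [|x' w'] //= eP [_ eQ].
have shP : shape (ptab w) = shape (ptab w').
  by case: w w' eQ {eP IH} => [|y w] [|y' w'] //= [].
have [-> eP'] := ins_inj (ptab_col w) (ptab_col w') shP eP.
by rewrite (IH _ eP' eQ).
Qed.

Lemma rev_inj : injective (@rev nat).
Proof. exact: (can_inj (@revK nat)). Qed.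

Lemma sgmp0 p : sgm p (0, 0) = p.
Proof. by case: p => a b; rewrite /sgm /=; congr pair; lia. Qed.

Lemma colword_inj T T' : shape T = shape T' -> colword T = colword T' -> T = T'.
Proof.
move=> sh e; apply: (inj_map rev_inj); apply: eq_from_flatten_shape e _.
rewrite /shape -!map_comp; move: sh; rewrite /shape.
by rewrite (eq_map (f := size \o rev) (g := size)) => [->|s]; rewrite /= ?size_rev //;
  apply: eq_map => s' /=; rewrite size_rev.
Qed.

(** * Insertion commutes with the operators *)

Section Local.
Variable i : nat.

Notation neut := (all (fun x => (x != i) && (x != i.+1))).

(** A column contains i and i+1 at most once each, and every other letter is neutral: for a given i
    there are only four types of columns to examine. *)
Lemma col_split C : col C -> exists A M B,
  [/\ C = A ++ M ++ B, all (fun a => a < i) A, all (fun b => i.+1 < b) B &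
      [\/ M = [::], M = [:: i], M = [:: i.+1] | M = [:: i; i.+1]]].
Proof.
elim: C => [|c C IH] cC; first by exists [::], [::], [::]; split=> //; constructor 1.
have hC : all (fun b => c < b) C by move: cC; rewrite -[c :: C]cat0s col_mid => /and5P[].
have /IH[A [M [B [e hA hB hM]]]] := path_sorted cC.
have [ci|ic] := ltnP c i.
  by exists (c :: A), M, B; split=> //=; rewrite ?e // ci.
have A0 : A = [::].
  case: A e hA => // a A e /= /andP[]; move: hC; rewrite e /= => /andP[]; lia.
rewrite A0 /= in e; exists [::].
have [ci|ci|ci] := ltngtP c i.+1.
- have ei : c = i by lia.
  exists (c :: M), B; rewrite ei; split=> //=; first by rewrite e.
  move: hC; rewrite e ei; case: hM => -> /=; rewrite ?ltnn // => _; [by constructor 2|by constructor 4].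
- exists [::], (c :: C); split=> //=; last by constructor 1.
  by rewrite ci /=; apply: sub_all hC => b /=; lia.
exists [:: c], C; split=> //=; last by rewrite ci; constructor 3.
by rewrite -ci.
Qed.

Lemma neut_lt A : all (fun a => a < i) A -> neut A.
Proof. by apply: sub_all => a /=; lia. Qed.

Lemma neut_gt A : all (fun a => i.+1 < a) A -> neut A.
Proof. by apply: sub_all => a /=; lia. Qed.

Lemma bump_neut_gt x A : i.+1 < x -> all (fun a => i.+1 < a) A ->
  neut (bump x A).1 /\ neut (bump x A).2.
Proof.
move=> xi hA; apply/andP; rewrite -all_cat (perm_all _ (perm_bump x A)) /=.
by rewrite neut_gt // andbT; lia.
Qed.

Lemma sg_neut_rev A : neut A -> sg i (rev A) = (0, 0).
Proof. by move=> h; rewrite sg_neutral // all_rev. Qed.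

(** Bumping seen as a rewriting of [x :: rev C]: the new column read from its bottom, then the
    letter handed to the next column. *)
Definition bword (x : nat) (C : seq nat) := rev (bump x C).1 ++ (bump x C).2.

(** An insertion that stops among the entries below i exchanges neutral letters and leaves the rest
    of the column alone. *)
Lemma bump_low x A : all (fun a => a < i) A -> ~~ all (fun a => a < x) A ->
  exists A' y, [/\ forall K, bump x (A ++ K) = (A' ++ K, [:: y]),
    neut A' , y < i, x < i & size A' = size A].
Proof.
move=> hA; case: (bumpP x A) => [->//|A1 y B e h xy _].
move: hA; rewrite e all_cat /= => /and3P[hA1 yi hB].
exists (A1 ++ x :: B), y; split=> //.
- by move=> K; rewrite -catA bump_cat //= xy -catA.
- by rewrite all_cat /= !neut_lt //= andbT; lia.
- exact: leq_ltn_trans xy yi.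
- by rewrite !size_cat.
Qed.

Ltac revs := rewrite ?(rev_cat, rev_cons) -?cats1 -?catA /= ?cats0.

(** The two words differ in one letter, either [x] or the i+1 of the column. After bumping they
    again differ in one letter, in the new column or in the bumped letter; the difference may pass
    from one place to the other, which the type of the column decides. *)
Lemma bump_estep x C x2 C2 : col C -> estep i (x :: rev C) (x2 :: rev C2) ->
  estep i (bword x C) (bword x2 C2) /\ size (bump x C).1 = size (bump x2 C2).1.
Proof.
move=> /col_split[A [M [B [eC hA hB hM]]]].
have nA := sg_neut_rev (neut_lt hA); have nB := sg_neut_rev (neut_gt hB).
have sgC : sg i (rev C) = sg i (rev M).
  by rewrite eC !rev_cat !sg_cat nA nB /sgm /=; case: (sg i (rev M)) => a b /=; congr pair; lia.
rewrite estep_consP sgC => -[[-> [-> /rev_inj ->] ph]|[w' [[-> <-] eM le]]].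
  have hA1 : all (fun a => a < i.+1) A by apply: sub_all hA => a /=; lia.
  rewrite eC /bword (bump_cat _ hA1) (bump_cat _ hA) /=.
  case: hM ph => -> /= ph.
  - case: B hB {nB eC} => [|b B] /= hB.
      split; last by rewrite !size_cat.
      by exists [::], (rev A); split; revs => //; rewrite nA.
    move: hB => /andP[ib hB]; have nB := sg_neut_rev (neut_gt hB).
    rewrite !(ltnW ib) (ltnW (ltnW ib)) /=; split; last by rewrite !size_cat.
    exists (rev B), (rev A ++ [:: b]); split; revs => //; first by rewrite nB.
    by rewrite sg_cat nA /= /sgm /sgl /=; lia.
  - by move: ph; rewrite /rev /= /sgm /sgl /=; lia.
  - rewrite ?leqnn ?leqnSn /=; split; last by rewrite !size_cat.
    exists (rev B), (rev A ++ [:: i.+1]); split; revs => //; first by rewrite nB.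
    by rewrite sg_cat nA /= /sgm /sgl /=; lia.
  (* The column contains both i and i+1: inserting either of them leaves it unchanged and bumps that
     same letter, so the difference moves to the bumped letter. *)
  rewrite ?ltnn ?leqnn /= ?leqnn /=; split; last by rewrite !size_cat.
  exists (rev B ++ i.+1 :: i :: rev A), [::]; split; revs => //.
  by rewrite sg_cat /= nA nB /= /sgm /sgl /=; lia.
(* Now e_i acts inside the column, whose only type with an uncanceled - is the one with i+1 alone.
   Also [x] is not i+1, since it would then be an uncanceled - further left. *)
have [_ ep] := sg_estep eM; rewrite sgC in ep.
have {hM} eqM : M = [:: i.+1].
  by case: hM ep => -> //; rewrite /rev /= /sgm /sgl /= => h; exfalso; lia.
have eC2 : C2 = A ++ i :: B.
  apply: rev_inj; apply: estep_fun eM _; rewrite eC eqM.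
  by exists (rev B), (rev A); split; revs; rewrite ?nA ?nB.
have xi : x != i.+1 by move: le; rewrite eqM /rev /= /sgm /sgl /=; lia.
rewrite eC2 eC eqM /bword; have [ix|xi'] := ltnP i.+1 x.
  have hA1 : all (fun a => a < x) (A ++ [:: i.+1]).
    by rewrite all_cat /= ix !andbT; apply: sub_all hA => a /=; lia.
  have hA2 : all (fun a => a < x) (A ++ [:: i]).
    by rewrite all_cat /= (ltnW ix) !andbT; apply: sub_all hA => a /=; lia.
  rewrite catA bump_cat //= -[A ++ i :: B]cat_rcons -cats1 bump_cat //=.
  have [n1 n2] := bump_neut_gt ix hB; split; last by rewrite !size_cat.
  exists (rev (bump x B).1), (rev A ++ (bump x B).2); split; revs => //.
    by rewrite sg_neut_rev.
  by rewrite sg_cat nA sg_neutral.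
have [hx|/(bump_low hA)[A' [y [bK nA' yi xi2 sA]]]] := boolP (all (fun a => a < x) A).
  rewrite !(bump_cat _ hx) /=; have -> : x <= i by lia.
  rewrite xi' /=; split; last by rewrite !size_cat.
  exists (rev B ++ x :: rev A), [::]; split; revs => //.
  by rewrite sg_cat /= nA nB /= /sgm /sgl /=; lia.
rewrite !bK /=; split; last by rewrite !size_cat.
exists (rev B), (rev A' ++ [:: y]); split; revs => //; first by rewrite nB.
by rewrite sg_cat (sg_neut_rev nA') /= /sgm /sgl /=; lia.
Qed.

(** Together with the tensor product rule, this ensures that bumping does not change which side of
    the cut after the first column e_i acts on. *)
Lemma bump_sg x C : col C -> sg i (bword x C) = sg i (x :: rev C).
Proof.
move=> /col_split[A [M [B [-> hA hB hM]]]].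
have nA := sg_neut_rev (neut_lt hA); have nB := sg_neut_rev (neut_gt hB).
have sgC K : sg i (rev (A ++ K)) = sg i (rev K).
  by rewrite !rev_cat !sg_cat nA /sgm /=; case: (sg i (rev K)) => a b /=; congr pair; lia.
rewrite /bword /= sgC.
have [hx|/(bump_low hA)[A' [y [bK nA' yi xi2 sA]]]] := boolP (all (fun a => a < x) A); last first.
  rewrite bK /=; move: (M ++ B) => K.
  rewrite sg_cat rev_cat sg_cat (sg_neut_rev nA') /= /sgm /sgl /=.
  by case: (sg i _) => a b /=; congr pair; lia.
rewrite bump_cat //= sg_cat sgC; have [ix|xi'] := ltnP i.+1 x.
  have [n1 n2] := bump_neut_gt ix hB.
  rewrite bump_cat /=; last by case: hM => -> //=; lia.
  rewrite !rev_cat !sg_cat sg_neut_rev // nB (sg_neutral n2) /sgm /sgl /=.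
  by case: (sg i _) => a b /=; congr pair; lia.
case: hM => -> /=.
- case: B hB {nB} => [|b B] /= hB.
    by rewrite /rev /= /sgm /=; congr pair; lia.
  move: hB => /andP[ib hB]; have nB := sg_neut_rev (neut_gt hB).
  have -> /= : x <= b by lia.
  by revs; rewrite !sg_cat nB /= /sgm /sgl /=; congr pair; lia.
- case: leqP => xi /=; first by revs; rewrite !sg_cat nB /= /sgm /sgl /=; congr pair; lia.
  case: B hB {nB} => [|b B] /= hB.
    by rewrite /rev /= /sgm /sgl /=; congr pair; lia.
  move: hB => /andP[ib hB]; have nB := sg_neut_rev (neut_gt hB).
  have -> /= : x <= b by lia.
  by revs; rewrite !sg_cat nB /= /sgm /sgl /=; congr pair; lia.
- by rewrite xi' /=; revs; rewrite !sg_cat nB /= /sgm /sgl /=; congr pair; lia.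
rewrite xi'; case: leqP => xi /=; revs; rewrite !sg_cat nB /= /sgm /sgl /=; congr pair; lia.
Qed.

Lemma colword_cons C T : colword (C :: T) = rev C ++ colword T.
Proof. by []. Qed.

Lemma ins_sg x T : all (fun C => col C) T -> sg i (colword (ins x T)) = sg i (x :: colword T).
Proof.
elim: T x => [|C T IH] x //=  /andP[cC cT].
have := bump_sg x cC; rewrite /bword; case: (bumpP x C) => [_|A y B _ _ _] h;
  rewrite !colword_cons.
  by move: h; rewrite /= cats0 => h; rewrite !sg_cat h /= sgmA.
move: h; rewrite /= sg_cat /= sgmp0 => h.
by rewrite sg_cat IH //= sg_cat !sgmA h.
Qed.

Lemma ptab_sg w : sg i (colword (ptab w)) = sg i w.
Proof. by elim: w => //= x w IH; rewrite ins_sg ?ptab_col //= IH. Qed.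

(** The word is cut after the first column and the tensor product rule applied; bumping keeps the
    reduced words, so the rule decides alike afterwards. The result is then cut again between the
    new column and the bumped letter, which begins the word for the induction hypothesis. *)
Lemma ins_estep x T x2 T2 : all (fun C => col C) T -> shape T2 = shape T ->
  estep i (x :: colword T) (x2 :: colword T2) ->
  estep i (colword (ins x T)) (colword (ins x2 T2)) /\ shape (ins x T) = shape (ins x2 T2).
Proof.
elim: T x x2 T2 => [|C T IH] x x2 [|C2 T2] //= /andP[cC cT] [sC sT].
rewrite !colword_cons -!cat_cons => eE.
have [eB sB] : estep i (bword x C ++ colword T) (bword x2 C2 ++ colword T2) /\
    size (bump x C).1 = size (bump x2 C2).1.
  case/estep_catP: eE => [[p' [e eE lt]]|[t' [e eE le]]]; move/eqP: e.
    have szp : size p' = size (x2 :: rev C2).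
      case: eE => u [s [eu -> _ _]]; have := congr1 size eu.
      by rewrite /= !size_cat /= !size_rev sC.
    rewrite eqseq_cat // => /andP[/eqP ep /eqP ->]; rewrite -ep in eE.
    have [eb ->] := bump_estep cC eE; split=> //.
    by apply/estep_catP; left; exists (bword x2 C2); split=> //; rewrite bump_sg.
  rewrite eqseq_cat /= ?size_rev ?sC // eqseq_cons => /andP[/andP[/eqP -> /eqP/rev_inj ->] /eqP et].
  by split=> //; apply/estep_catP; right; exists t'; rewrite et; split=> //; rewrite bump_sg.
(* Old and new heights give the number of bumped letters, so both insertions bump or neither
   does. *)
have szo z K : size (bump z K).2 = (size K).+1 - size (bump z K).1.
  by have := perm_size (perm_bump z K); rewrite size_cat /= => <-; lia.
have := szo x2 C2; rewrite sC -sB -szo; move: eB sB; rewrite /bword.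
have so1 z K : size (bump z K).2 <= 1 by case: bumpP.
have := (so1 x C, so1 x2 C2).
case: (bump x C) => D o; case: (bump x2 C2) => D2 o2 /= -[so so2] {}eE sD so12.
case: o so so12 eE => [|y [|? ?]] //= _; case: o2 so2 => [|y2 [|? ?]] //= _ _ eE.
  by rewrite !colword_cons; move: eE; rewrite !cats0 sD sT.
rewrite !colword_cons; move: eE; rewrite -!catA /=.
case/estep_catP => [[p' [e eE lt]]|[t' [e eE le]]]; move/eqP: e.
  have szp : size p' = size (rev D2).
    by case: eE => u [s [eu -> _ _]]; have := congr1 size eu; rewrite !size_cat !size_rev sD => ->.
  rewrite eq_sym eqseq_cat // eqseq_cons => /and3P[/eqP ep /eqP ey /eqP/(colword_inj (esym sT)) eT].
  rewrite sD -ey -eT; split=> //; apply/estep_catP; left; exists (rev D2); rewrite -ep; split=> //.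
  by rewrite ins_sg.
rewrite eqseq_cat /= ?size_rev ?sD // => /andP[/eqP/rev_inj -> /eqP et].
rewrite -et in eE; have [e1 ->] := IH _ _ _ cT sT eE; split=> //.
apply/estep_catP; right; exists (colword (ins y2 T2)); split=> //; by rewrite ins_sg.
Qed.

Lemma ptab_estep w w' : estep i w w' ->
  [/\ estep i (colword (ptab w)) (colword (ptab w')), shape (ptab w) = shape (ptab w')
    & qshapes w = qshapes w'].
Proof.
elim: w w' => [|x w IH] w'; first by case=> -[|? ?] [? []].
case/estep_consP => [[-> -> ph]|[w1 [-> /IH[h1 h2 h3] le]]] /=.
  have [//||e ->] := @ins_estep i.+1 (ptab w) i (ptab w) (ptab_col w); last by [].
  by apply/estep_consP; left; rewrite ptab_sg.
have [//||e ->] := @ins_estep x (ptab w) x (ptab w1) (ptab_col w); last by split=> //; rewrite h3.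
  by apply/estep_consP; right; exists (colword (ptab w1)); rewrite ptab_sg.
Qed.

End Local.

(* Inserting k+1 in a superstandard tableau passes unchanged through the columns
   of height > k and lands on the first one of height k. *)
Lemma ins_iota x hs c : (forall c', c' < c -> x < nth 0 hs c') -> nth 0 hs c = x ->
  ins x.+1 (map (iota 1) hs) = map (iota 1) (incr_nth hs c).
Proof.
have iS : iota 1 x.+1 = iota 1 x ++ [:: x.+1] by rewrite -[X in iota 1 X]addn1 iotaD.
elim: c hs => [|c IH] [|h hs] //= hlt hx.
- by rewrite -hx.
- rewrite hx; have -> : iota 1 x = iota 1 x ++ [::] by rewrite cats0.
  rewrite bump_cat /=; last by apply/allP => a; rewrite mem_iota add1n => /andP[].
  by move: iS => /= ->.
- by have := hlt 0 isT.
have xh : x < h := hlt 0 isT.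
have -> : iota 1 h = iota 1 x ++ x.+1 :: iota x.+2 (h - x.+1).
  have eh : h = x + (h - x.+1).+1 by lia.
  by rewrite [in LHS]eh iotaD add1n.
rewrite bump_cat /=; last by apply/allP => a; rewrite mem_iota add1n => /andP[].
rewrite ltnSn /= IH // => c' h'; exact: (hlt c'.+1).
Qed.

(** * Highest weight words *)

Definition hwword (w : seq nat) : Prop :=
  0 \notin w /\ forall i, 0 < i -> eps i w = 0.

(** The condition says that every suffix has at least as many i as i+1. It forces P to be
    superstandard, and [hs], its column heights, is the conjugate of the weight. *)
Lemma ptab_hw w : hwword w -> exists hs,
  [/\ ptab w = map (iota 1) hs, 0 \notin hs &
      forall k c, (k < nth 0 hs c) = (c < count_mem k.+1 w)].
Proof.
elim: w => [|x w IH] [w0 hw]; first by exists [::]; split=> // k c; rewrite nth_nil.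
have {}w0 : x != 0 /\ 0 \notin w.
  by move: w0; rewrite in_cons negb_or eq_sym => /andP[].
case: w0 => x0 w0; have {IH}[|hs [e hs0 hk]] := IH.
  by split=> // i i0; have := hw i i0; rewrite /= /sgm /=; lia.
case: x x0 hw => // x _ hw.
have lt c' : c' < count_mem x.+1 w -> x < nth 0 hs c' by rewrite hk.
(* The columns higher than [x] are as many as the letters [x.+1] of [w]; the suffix condition makes
   the next column exactly [x] high, so [x.+1] lands under it. *)
have eq : nth 0 hs (count_mem x.+1 w) = x.
  apply/eqP; rewrite eqn_leq leqNgt hk ltnn /=.
  case: x hw {lt} => // x hw; rewrite hk.
  have := hw x.+1 isT; have := count_sg x.+1 w; rewrite /= /sgm /sgl /= eqxx /=.
  by move: (count_mem _ w) (count_mem _ w) => a b; lia.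
exists (incr_nth hs (count_mem x.+1 w)); split.
- by rewrite /= e (ins_iota lt eq).
- apply/negP => /(nthP 0)[c]; rewrite size_incr_nth nth_incr_nth => hc hz.
  case: (ltnP c (size hs)) => h; last first.
    have : c < count_mem x.+1 w by move: hc hz; case: ifP; lia.
    by move/lt; rewrite nth_default.
  by move: hs0; rewrite (_ : 0 = nth 0 hs c) ?mem_nth //; lia.
move=> k c; rewrite nth_incr_nth /=; have := hk k c; have := hk k (count_mem x.+1 w).
case: (eqVneq x k) => [exk|ne]; last first.
  by case: (eqVneq (count_mem x.+1 w) c) => [ec|ne2] /=; subst; lia.
subst k; rewrite eqxx; move: eq; move: (count_mem x.+1 w) => m eq.
by case: (eqVneq m c) => [ec|ne2] /=; subst; lia.
Qed.

Lemma nth0_inj (s t : seq nat) : 0 \notin s -> 0 \notin t ->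
  (forall k, nth 0 s k = nth 0 t k) -> s = t.
Proof.
move=> s0 t0 e; have aux (u v : seq nat) : 0 \notin u -> (forall k, nth 0 u k = nth 0 v k) ->
    size u <= size v.
  move=> u0 euv; rewrite leqNgt; apply/negP => lt.
  by move: u0; rewrite (_ : 0 = nth 0 u (size v)) ?mem_nth // euv nth_default.
apply: (@eq_from_nth _ 0) => [|k _]; last exact: e.
by apply/eqP; rewrite eqn_leq !aux.
Qed.

Lemma ptab_hw_content w w' : hwword w -> hwword w' ->
  (forall k, count_mem k.+1 w = count_mem k.+1 w') -> ptab w = ptab w'.
Proof.
move=> /ptab_hw[hs [-> h0 hk]] /ptab_hw[hs' [-> h0' hk']] e.
congr (map _ _); apply: nth0_inj => // c.
have ee k : (k < nth 0 hs c) = (k < nth 0 hs' c) by rewrite hk hk' e.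
by apply/eqP; rewrite eqn_leq; apply/andP; split; rewrite leqNgt -?ee ?ltnn // ee ltnn.
Qed.

Lemma ptab_hw_shape w w' : hwword w -> hwword w' ->
  shape (ptab w) = shape (ptab w') -> ptab w = ptab w'.
Proof.
have shi hs : shape (map (iota 1) hs) = hs.
  by rewrite /shape -map_comp -[RHS]map_id; apply: eq_map => h; rewrite /= size_iota.
by move=> /ptab_hw[hs [-> _ _]] /ptab_hw[hs' [-> _ _]]; rewrite !shi => ->.
Qed.

(** * Valued-set tableaux *)

Section Cells.
Variable A : Type.
Implicit Types (T : seq (seq A)) (sh : seq nat) (F : nat -> nat -> A).

Lemma shape_fill sh F : shape (fill sh F) = sh.
Proof.
apply: (@eq_from_nth _ 0); rewrite /shape /fill size_map size_mkseq // => r hr.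
by rewrite (nth_map [::]) ?size_mkseq // nth_mkseq // size_mkseq.
Qed.

Lemma cell_fill (x0 : A) sh F r c :
  cell x0 (fill sh F) r c = if c < nth 0 sh r then F r c else x0.
Proof.
rewrite /cell /fill; case: (ltnP r (size sh)) => hr; last first.
  by rewrite (nth_default [::]) ?size_mkseq // nth_nil nth_default.
rewrite (nth_mkseq _ _ hr); case: ifPn => h; first by rewrite nth_mkseq.
by rewrite nth_default // size_mkseq leqNgt.
Qed.

Lemma nth_shape T r : nth 0 (shape T) r = size (nth [::] T r).
Proof.
case: (ltnP r (size T)) => h; first by rewrite (nth_map [::]).
by rewrite !nth_default ?size_map.
Qed.

Lemma cell_out (x0 : A) T r c : nth 0 (shape T) r <= c -> cell x0 T r c = x0.
Proof. by move=> h; rewrite /cell nth_default // -nth_shape. Qed.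

Lemma cell_inj (x0 : A) T T' : shape T = shape T' ->
  (forall r c, c < nth 0 (shape T) r -> cell x0 T r c = cell x0 T' r c) -> T = T'.
Proof.
move=> sh e; have sz : size T = size T' by rewrite -!(size_map size) -/(shape T) sh.
apply: (@eq_from_nth _ [::]) => // r hr; apply: (@eq_from_nth _ x0).
  by rewrite -!nth_shape sh.
by move=> c hc; apply: e; rewrite nth_shape.
Qed.

End Cells.

(** The strict reading order of boxes. As [buoys] is sorted for it, positions in the word are
    compared through coordinates. *)
Definition rlt (b b' : nat * nat) : bool :=
  (b.2 < b'.2) || ((b.2 == b'.2) && (b'.1 < b.1)).

Lemma rlt_trans : transitive rlt.
Proof. by move=> [r c] [r1 c1] [r2 c2]; rewrite /rlt /=; lia. Qed.

Lemma rlt_irr : irreflexive rlt.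
Proof. by move=> [r c]; rewrite /rlt /=; lia. Qed.

Lemma reading_order_sorted sh : sorted rlt (reading_order sh).
Proof.
apply: (sorted_filter rlt_trans); rewrite (sorted_pairwise rlt_trans).
move: (iota_ltn_sorted 0 (head 0 sh)); rewrite (sorted_pairwise ltn_trans).
elim: (iota 0 _) => //= c cs IH /andP[hc /IH {}IH].
rewrite pairwise_cat IH andbT; apply/andP; split.
  apply/allrelP => x y /mapP[r _ ->] /allpairsPdep[c' [r' [h _ ->]]].
  by rewrite /rlt /= (allP hc _ h).
rewrite pairwise_map -(sorted_pairwise) ?rev_sorted; last first.
  by move=> r1 r2 r3; rewrite /relpre /rlt /=; lia.
by apply: sub_sorted (iota_ltn_sorted 0 (size sh)) => r r'; rewrite /rlt /= => ->; rewrite eqxx orbT.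
Qed.

Lemma partition_mono lam r r' : is_partition lam -> r <= r' -> nth 0 lam r' <= nth 0 lam r.
Proof.
case/andP=> srt _ rr'; case: (ltnP r' (size lam)) => h; last by rewrite nth_default.
have tr : transitive geq by move=> y x z yx zy; exact: leq_trans zy yx.
by apply: (sorted_leq_nth tr leqnn 0 srt r r') => //; rewrite inE; lia.
Qed.

Lemma mem_reading_order lam r c : is_partition lam ->
  ((r, c) \in reading_order lam) = (c < nth 0 lam r).
Proof.
move=> plam; rewrite mem_filter /=; case: ltnP => //= h.
apply/allpairsPdep; exists c, r; rewrite mem_rev !mem_iota /= !add0n; split=> //.
  exact: leq_trans h (partition_le_head r plam).
by rewrite ltnNge; apply/negP => h'; rewrite nth_default in h.
Qed.

Definition rd (V : vtab) : seq nat := map (vst_letter V) (buoys V).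
Definition cols (V : vtab) : seq nat := map snd (buoys V).

Lemma buoys_sorted V : sorted rlt (buoys V).
Proof. exact: (sorted_filter rlt_trans) (reading_order_sorted _). Qed.

Section OneVST.
Variables (lam : seq nat) (V : vtab).
Hypotheses (plam : is_partition lam) (vV : is_vst lam V).

Lemma vst_shape1 : shape V.1 = lam. Proof. by case: vV => -[]. Qed.
Lemma vst_shape2 : shape V.2 = lam. Proof. by case: vV. Qed.

Lemma buoy_in r c : is_buoy V r c -> c < nth 0 lam r.
Proof. by apply: contraTltn; rewrite -vst_shape2 => h; rewrite cell_out. Qed.

Lemma mem_buoys r c : ((r, c) \in buoys V) = is_buoy V r c.
Proof.
rewrite mem_filter /= vst_shape1 mem_reading_order //.
by case: (boolP (is_buoy V r c)) => //= /buoy_in ->.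
Qed.

Lemma ent_pos r c : c < nth 0 lam r -> 0 < entry V.1 r c.
Proof. by case: vV => -[_ + _ _] _ _ _; apply. Qed.

Lemma ent_row r c c' : c <= c' -> c' < nth 0 lam r -> entry V.1 r c <= entry V.1 r c'.
Proof.
case: vV => -[_ _ + _] _ _ _; move=> row; elim: c' => [|c' IH].
  by rewrite leqn0 => /eqP ->.
rewrite leq_eqVlt => /orP[/eqP -> //|cc'] h.
exact: leq_trans (IH cc' (ltnW h)) (row _ _ h).
Qed.

Lemma ent_col r r' c : r < r' -> c < nth 0 lam r' -> entry V.1 r c < entry V.1 r' c.
Proof.
case: vV => -[_ _ _ col] _ _ _; elim: r' => // r' IH.
rewrite ltnS leq_eqVlt => /orP[/eqP ->|rr'] h; first exact: col.
apply: ltn_trans (IH rr' _) (col _ _ h).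
exact: leq_trans h (partition_mono plam _).
Qed.

Lemma ent_geS r c : c < nth 0 lam r -> r < entry V.1 r c.
Proof.
elim: r => [|r IH] h; first exact: ent_pos.
have h' : c < nth 0 lam r := leq_trans h (partition_mono plam (leqnSn r)).
exact: leq_ltn_trans (IH h') (ent_col _ h).
Qed.

Lemma nbuoy_left r c : c < nth 0 lam r -> ~~ is_buoy V r c ->
  0 < c /\ entry V.1 r c.-1 = entry V.1 r c.
Proof.
case: vV => _ _ b0 bS; case: c => [h|c h]; first by rewrite b0.
by move=> nb; split=> //; apply/eqP; apply: contraNT nb; apply: bS.
Qed.

Lemma buoy_left r c : c < nth 0 lam r -> exists c0,
  [/\ c0 <= c, is_buoy V r c0 &
      forall c', c0 <= c' <= c -> entry V.1 r c' = entry V.1 r c].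
Proof.
elim: c => [|c IH] h.
  exists 0; split=> //; first by case: vV => _ _ + _; apply.
  by move=> c'; rewrite leqn0 => /eqP ->.
case: (boolP (is_buoy V r c.+1)) => [b|/(nbuoy_left h)[_ /= e]].
  by exists c.+1; split=> // c' /anti_leq ->.
case: (IH (ltnW h)) => c0 [h0 b0 e0]; exists c0; split=> //; first exact: leqW.
move=> c' /andP[h1]; rewrite leq_eqVlt => /orP[/eqP -> //|h2].
by rewrite e0 ?e // h1.
Qed.

Lemma anchorP r c (a := anchor V r c) : c < nth 0 lam r ->
  [/\ c <= a < nth 0 lam r, forall c', c < c' <= a -> ~~ is_buoy V r c',
      a.+1 < nth 0 lam r -> is_buoy V r a.+1 &
      forall c', c <= c' <= a -> entry V.1 r c' = entry V.1 r c].
Proof.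
rewrite {}/a /anchor; set s := drop _ _ => h.
have szs : size s = nth 0 lam r - c.+1 by rewrite size_drop -nth_shape vst_shape2.
have cs k : cell false V.2 r (c.+1 + k) = nth false s k by rewrite nth_drop.
have ha : c <= c + find id s < nth 0 lam r.
  by rewrite leq_addr /=; have := find_size id s; lia.
have nb c' : c < c' <= c + find id s -> ~~ is_buoy V r c'.
  move=> h'; have -> : c' = c.+1 + (c' - c.+1) by lia.
  by rewrite cs; have /(before_find false)/= -> : c' - c.+1 < find id s by lia.
split=> //.
  move=> h'; rewrite -addSn cs; apply: (nth_find false (a := id)).
  by rewrite has_find; lia.
move=> c'; case/andP: ha => _ ha; elim: c' => [|c' IH] /andP[h1 h2].
  by have -> : c = 0 by lia.
move: h1; rewrite leq_eqVlt => /orP[/eqP <- //|h1].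
rewrite -IH; last by lia.
by have [||_ /= ->] := @nbuoy_left r c'.+1; rewrite ?nb //; lia.
Qed.

(** A group contains no buoy besides its own, so just one letter of the word changes. *)
Lemma rd_recolor r c x u s : buoys V = u ++ (r, c) :: s ->
  rd (recolor V r c x) = map (vst_letter V) u ++ x :: map (vst_letter V) s
  /\ cols (recolor V r c x) = cols V.
Proof.
move=> e; have eb : buoys (recolor V r c x) = buoys V.
  by rewrite /buoys /recolor /= shape_fill.
have hc : is_buoy V r c by rewrite -mem_buoys e mem_cat mem_head orbT.
have cl := buoy_in hc; have [/andP[ca al] nb _ _] := anchorP cl.
rewrite /rd /cols eb; split=> //.
have lt b : b \in buoys V -> b != (r, c) ->
    vst_letter (recolor V r c x) b = vst_letter V b.
  case: b => r' c'; rewrite mem_buoys => b ne.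
  rewrite /vst_letter /recolor /= cell_fill vst_shape1 (buoy_in b).
  case: ifP => // /and3P[/eqP er h1 h2]; move: b ne; rewrite er => b ne.
  exfalso; move: b; apply/negP; apply: nb; rewrite h2 andbT ltn_neqAle h1 andbT.
  by apply: contra ne => /eqP ->.
have un : uniq (buoys V) := sorted_uniq rlt_trans rlt_irr (buoys_sorted V).
rewrite e map_cat /=; congr (_ ++ _ :: _).
- apply/eq_in_map => b bu; apply: lt; first by rewrite e mem_cat bu.
  by apply: contraTneq un => eb'; rewrite e cat_uniq /= -eb' bu /= andbF.
- by rewrite /vst_letter /recolor /= cell_fill vst_shape1 cl eqxx leqnn ca.
apply/eq_in_map => b bs; apply: lt; first by rewrite e mem_cat in_cons bs !orbT.
by apply: contraTneq un => eb'; rewrite e cat_uniq /= -eb' bs /= !andbF.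
Qed.

(** The two boxes are vertical neighbours, and no box is read between them; the new buoy takes the
    place of the old one in the word. *)
Lemma rd_move (r r2 c : nat) u s : buoys V = u ++ (r, c) :: s -> (r2 == r.+1) || (r == r2.+1) ->
  c < nth 0 lam r2 -> ~~ is_buoy V r2 c ->
  rd (move_divider V r r2 c) =
    map (vst_letter V) u ++ entry V.1 r2 c :: map (vst_letter V) s
  /\ cols (move_divider V r r2 c) = cols V.
Proof.
move=> e adj c2 nb2; set V' := move_divider V r r2 c.
have srt : sorted rlt (u ++ (r, c) :: s) by rewrite -e; apply: buoys_sorted.
have : buoys V' = u ++ (r2, c) :: s; last first.
  by move=> eb; rewrite /rd /cols eb e !map_cat /=.
apply: (irr_sorted_eq rlt_trans rlt_irr (buoys_sorted _)).
  move: srt; rewrite !(sorted_pairwise rlt_trans) !pairwise_cat /= !allrel_consr.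
  move=> /and4P[/andP[h1 h2] -> h3 ->]; rewrite !andbT h2 /= andbT.
  have nin b : b \in u ++ (r, c) :: s -> b != (r2, c).
    by rewrite -e; case: b => r' c'; rewrite mem_buoys; apply: contraTneq => -[-> ->].
  apply/andP; split.
    apply/allP => b bu; have := allP h1 _ bu; have : b != (r2, c).
      by apply: nin; rewrite mem_cat bu.
    by case: b {bu} => r' c'; rewrite xpair_eqE /rlt /=; lia.
  apply/allP => b bs; have := allP h3 _ bs; have : b != (r2, c).
    by apply: nin; rewrite mem_cat in_cons bs !orbT.
  by case: b {bs} => r' c'; rewrite xpair_eqE /rlt /=; lia.
have un : uniq (u ++ (r, c) :: s) := sorted_uniq rlt_trans rlt_irr srt.
move=> [r' c']; rewrite mem_filter mem_reading_order /= ?vst_shape1 // cell_fill vst_shape2.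
have := mem_buoys r' c'; rewrite e !mem_cat !in_cons !xpair_eqE => h.
have hin := @buoy_in r' c'.
case: (boolP ((r' == r) && (c' == c))) => [/andP[/eqP er /eqP ec]|ne] /=.
  subst; move: un; rewrite cat_uniq /= negb_or => /and3P[_ /andP[/negbTE -> _] /andP[/negbTE -> _]] /=.
  by rewrite orbF if_same /=; lia.
rewrite (negbTE ne) /= in h; case: (boolP ((r' == r2) && (c' == c))) => [/andP[/eqP -> /eqP ->]|ne2] /=.
  by rewrite c2 orbT.
rewrite h; case: ltnP => h'; rewrite ?andbT //.
by case: (boolP (is_buoy V r' c')) => // /hin; lia.
Qed.

Lemma is_vst_recolor r c x (a := anchor V r c) : 0 < x -> is_buoy V r c ->
  (forall r' c', c <= c' <= a -> r = r'.+1 -> entry V.1 r' c' < x) ->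
  (forall c', c <= c' <= a -> c' < nth 0 lam r.+1 -> x < entry V.1 r.+1 c') ->
  (0 < c -> entry V.1 r c.-1 <= x) ->
  (a.+1 < nth 0 lam r -> x <= entry V.1 r a.+1) ->
  is_vst lam (recolor V r c x).
Proof.
move=> x0 bc above below left right; have cl := buoy_in bc.
have [ca nb ba ea] := anchorP cl; rewrite -/a in ca nb ba ea.
have ent r' c' : c' < nth 0 lam r' -> entry (recolor V r c x).1 r' c' =
    if (r' == r) && (c <= c' <= a) then x else entry V.1 r' c'.
  by move=> h; rewrite cell_fill vst_shape1 h.
split; first split.
- by rewrite shape_fill vst_shape1.
- by move=> r' c' h; rewrite ent //; case: ifP => // _; apply: ent_pos.
- move=> r' c' h; rewrite !ent //; last exact: ltnW.
  case: (eqVneq r' r) => /= [er|_]; last exact: ent_row.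
  rewrite er in h *; case: ifP => h1; case: ifP => h2 //; last by apply: ent_row.
  + have ec : c' = a by lia.
    by rewrite ec; apply: right; rewrite -ec.
  + have ec : c = c'.+1 by lia.
    by have := left; rewrite ec; apply.
- move=> r' c' h; have h' : c' < nth 0 lam r' := leq_trans h (partition_mono plam (leqnSn r')).
  rewrite !ent //; case: (eqVneq r' r) => /= [er|ne].
    rewrite er in h *; rewrite gtn_eqF //=; case: ifP => h1; first exact: below.
    exact: ent_col.
  case: (eqVneq r'.+1 r) => /= [er|ne']; last exact: ent_col.
  by case: ifP => h1; [apply: above|apply: ent_col].
- exact: vst_shape2.
- by move=> r' h; case: vV => _ _ + _; apply.
- move=> r' c' h; rewrite !ent //; last exact: ltnW.
  case: (eqVneq r' r) => /= [er|_]; last by case: vV => _ _ _; apply.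
  rewrite er in h *; case: ifP => h1; case: ifP => h2.
  + by rewrite eqxx.
  + have ec : c' = a by lia.
    by move=> _; rewrite ec; apply: ba; rewrite -ec.
  + have ec : c = c'.+1 by lia.
    by rewrite -ec.
  + by case: vV => _ _ _; apply.
Qed.

Lemma is_vst_move (r r2 c : nat) : 0 < c -> entry V.1 r c.-1 = entry V.1 r c ->
  is_vst lam (move_divider V r r2 c).
Proof.
move=> c0 e; have [ssV _ b0 bS] := vV; split=> //.
- by rewrite shape_fill vst_shape2.
- move=> r' h; rewrite cell_fill vst_shape2 h b0 //.
  by case: ifP => [|_]; [lia|case: ifP].
move=> r' c' h ne; rewrite cell_fill vst_shape2 h bS //.
case: ifP => [/andP[/eqP er /eqP ec]|_]; last by case: ifP.
by move: ne e; rewrite er -ec /= => ne e; rewrite e eqxx in ne.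
Qed.

End OneVST.

(** * The operators on valued-set tableaux *)

Section Isolated.
Variables (V : vtab) (i : nat) (g : nat * nat).
Hypothesis isoV : isolated (vst_letter V) i g (buoys V).

(** No - before [g] is left uncanceled, and its partner is also read before [g]. This and its mirror
    image below turn the cancellation into statements about positions of boxes. *)
Lemma isolated_minus b : b \in buoys V -> rlt b g -> vst_letter V b = i.+1 ->
  exists b', [/\ b' \in buoys V, vst_letter V b' = i, rlt b b' & rlt b' g].
Proof.
case: isoV => u [s [e u0 _]] bV bg lb.
have := buoys_sorted V; rewrite (sorted_pairwise rlt_trans) e pairwise_cat allrel_consr /=.
move=> /and4P[/andP[hu _] pu hs _].
have bu : b \in u.
  move: bV; rewrite e mem_cat in_cons => /or3P[//|/eqP eb|bs].
    by move: bg; rewrite eb rlt_irr.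
  by have := rlt_trans bg (allP hs _ bs); rewrite rlt_irr.
case/splitPr: bu u0 hu pu => u1 u2; rewrite map_cat /= lb => /eps0_later/mapP[b' b'2 eb'].
move=> /allP hu; rewrite pairwise_cat /= => /and4P[_ _ /allP h _].
exists b'; split=> //; last first.
- by apply: hu; rewrite mem_cat in_cons b'2 !orbT.
- exact: h.
- by rewrite ?e !(mem_cat, in_cons) b'2 !orbT.
Qed.

Lemma isolated_plus b : b \in buoys V -> rlt g b -> vst_letter V b = i ->
  exists b', [/\ b' \in buoys V, vst_letter V b' = i.+1, rlt g b' & rlt b' b].
Proof.
case: isoV => u [s [e _ s0]] bV bg lb.
have := buoys_sorted V; rewrite (sorted_pairwise rlt_trans) e pairwise_cat allrel_consr /=.
move=> /and4P[/andP[hu _] _ hs ps].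
have bs : b \in s.
  move: bV; rewrite e mem_cat in_cons => /or3P[bu|/eqP eb|//].
    by have := rlt_trans bg (allP hu _ bu); rewrite rlt_irr.
  by move: bg; rewrite eb rlt_irr.
case/splitPr: bs s0 hs ps e => s1 s2; rewrite map_cat /= lb => /phi0_earlier/mapP[b' b'1 eb'].
move=> /allP hs; rewrite pairwise_cat /= allrel_consr => /and4P[/andP[/allP h _] _ _ _] e.
exists b'; split=> //; last first.
- exact: h.
- by apply: hs; rewrite mem_cat b'1.
- by rewrite ?e !(mem_cat, in_cons) b'1 !orbT.
Qed.

End Isolated.

Section Ops.
Variables (lam : seq nat) (V : vtab) (i : nat).
Hypotheses (plam : is_partition lam) (vV : is_vst lam V) (i0 : 0 < i).

Lemma row_lt r r' c : r <= r' -> c < nth 0 lam r' -> c < nth 0 lam r.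
Proof. by move=> h h'; apply: leq_trans h' (partition_mono plam h). Qed.

(** The main point is that the result is a valued-set tableau. A failure would exhibit a buoy whose
    letter must be canceled on its own side of [g], and the partner is ruled out by strictness of
    columns or by the case chosen in the definition. *)
Lemma vst_eP :
  match vst_e i V with
  | Some V' => [/\ is_vst lam V', estep i (rd V) (rd V'), cols V' = cols V &
                   forall n, i <= n -> entries_le n V.1 -> entries_le n V'.1]
  | None => eps i (rd V) = 0
  end.
Proof.
rewrite /vst_e; have := leftmost_minusP (vst_letter V) i (buoys V).
case: leftmost_minus => [[r c] [lg iso]|] //=.
have [u [s [eb u0 s0]]] := iso.
have eR : rd V = map (vst_letter V) u ++ i.+1 :: map (vst_letter V) s.
  by rewrite /rd eb map_cat /= lg.
have bg : is_buoy V r c by rewrite -(mem_buoys plam vV) eb mem_cat mem_head orbT.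
have mb r' c' := mem_buoys plam vV r' c'.
have cl := buoy_in vV bg; have [ca nb ba ea] := anchorP plam vV cl.
set a := anchor V r c in ca nb ba ea *; rewrite /vst_letter /= in lg.
have row := ent_row vV; have col := ent_col plam vV.
have [/andP[ca' al]] := (ca).
case: ifPn => [/andP[r0 /eqP eA]|nA].
  have [r1 er1] : exists r1, r = r1.+1 by exists r.-1; lia.
  clearbody a; subst r; move: r1 r0 => r _ in iso eb lg bg cl nb ba ea ca ca' al eA *.
  rewrite /= in eA *.
  (* Such a buoy would be a + read after [g]. Its - would lie in the columns of the group, where i+1
     occurs only in the group itself, which has no further buoy. *)
  have nbA c' : c <= c' <= a -> entry V.1 r c' = i -> ~~ is_buoy V r c'.
    move=> h ei; apply/negP => b.
    have [|||[r1 c1]] := isolated_plus iso (b := (r, c')).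
    - by rewrite mb.
    - by rewrite /rlt /=; lia.
    - exact: ei.
    rewrite mb /rlt /vst_letter /= => -[b1 l1 h1 h2].
    have c1l := buoy_in vV b1.
    have [lt|gt|er] := ltngtP r1 r.+1.
    + have h3 : c1 < nth 0 lam r.+1 by lia.
      have := col _ _ _ lt h3; rewrite ea ?lg; lia.
    + have h3 : c1 < nth 0 lam r.+1 := row_lt (ltnW gt) c1l.
      have := col _ _ _ gt c1l; rewrite ea ?lg; lia.
    + by subst r1; move: b1; apply/negP; apply: nb; lia.
  (* Leftward from the anchor: a box that is not a buoy repeats the entry on its left. *)
  have eAll c' : c <= c' <= a -> entry V.1 r c' = i.
    move=> h; have -> : c' = a - (a - c') by lia.
    have : a - c' <= a - c by lia.
    elim: (a - c') => [|k IH] hk; first by rewrite subn0.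
    have hk' : c <= a - k <= a by lia.
    have ek := IH (ltnW hk).
    have hl : a - k < nth 0 lam r by apply: (@row_lt r r.+1) => //; lia.
    have [_ e1] := nbuoy_left vV hl (nbA _ hk' ek).
    by rewrite -ek -e1; congr (entry _ _ _); lia.
  have ec := eAll c; rewrite leqnn ca' in ec; have {}ec := ec isT.
  have clr : c < nth 0 lam r := row_lt (leqnSn r) cl.
  have nbc : ~~ is_buoy V r c by apply: nbA => //; rewrite leqnn.
  have [c0 ec1] := nbuoy_left vV clr nbc.
  have [|eR' eC] := rd_move plam vV eb _ clr nbc; first by rewrite eqxx orbT.
  split=> //.
  - apply: is_vst_move => //; have h1 : c.-1 < nth 0 lam r.+1 by lia.
    have := col _ _ _ (ltnSn r) h1; have := row _ _ _ (leq_pred c) cl.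
    rewrite lg ec1 ec; lia.
  - by rewrite eR eR' ec; exists (map (vst_letter V) u), (map (vst_letter V) s).
have [eR' eC] := rd_recolor plam vV i eb.
split=> //.
- apply: is_vst_recolor => //.
  (* The entry above the anchor is below i+1 and is not i, hence is below i; so are the entries to
     its left. *)
  + move=> r' c' h er; have h1 : c' < nth 0 lam r by lia.
    have rr' : r' < r by rewrite er.
    have := col _ _ _ rr' h1; rewrite ea // lg.
    have := row r' c' a; have := col _ _ _ rr' al; rewrite ea ?leqnn ?ca' // lg.
    have := row_lt (ltnW rr') al; move: nA; rewrite er /=; lia.
  + move=> c' h h1; have := col _ _ _ (ltnSn r) h1; rewrite ea // lg; lia.
  (* An i+1 on the left would belong to a group whose - is canceled by a + higher up, in a column
     before [c]. The row just above then has an entry at least i there, hence i above the anchor,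
     and the other case would apply. *)
  + move=> c0; have cl1 : c.-1 < nth 0 lam r by lia.
    rewrite leqNgt; apply/negP => lt.
    have e1 : entry V.1 r c.-1 = i.+1.
      by have := row _ _ _ (leq_pred c) cl; rewrite lg; lia.
    have [c1 [hc1 b1 e1']] := buoy_left vV cl1.
    have [|||[r2 c2]] := isolated_minus iso (b := (r, c1)).
    * by rewrite mb.
    * by rewrite /rlt /=; lia.
    * by rewrite /vst_letter /= e1' ?e1 // leqnn.
    rewrite mb /rlt /vst_letter /= => -[b2 l2 h1 h2].
    have c2l := buoy_in vV b2.
    have [lt2|gt|er] := ltngtP r2 r.
    * have c2c : c2 < c by lia.
      have ec2 : entry V.1 r c2 = i.+1 by rewrite e1' ?e1 //; lia.
      move: nA; rewrite negb_and -leqNgt leqn0 => /orP[/eqP r0|]; first by lia.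
      move/negP; apply; apply/eqP.
      have hr : r.-1 < r by lia.
      have al1 := row_lt (leq_pred r) al.
      have := col _ _ _ hr al; rewrite ea ?ca' ?leqnn // lg.
      have := row r.-1 c2 a; have : entry V.1 r2 c2 <= entry V.1 r.-1 c2.
        have [->//|lt3] : r2 = r.-1 \/ r2 < r.-1 by lia.
        by apply/ltnW/col => //; apply: (@row_lt r.-1 r); lia.
      by rewrite l2; lia.
    * have h3 := row_lt (ltnW gt) c2l; have := col _ _ _ gt c2l; rewrite l2.
      have [c2c|cc2] := leqP c c2; first by have := row _ _ _ c2c h3; rewrite lg; lia.
      by rewrite e1' ?e1; lia.
    * subst r2; have [c2c|cc2] := leqP c c2; first by lia.
      by move: l2; rewrite e1' ?e1; lia.
  + by rewrite -/a => h; have := row _ _ _ (leqW ca') h; rewrite lg; apply: ltnW.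
- by rewrite eR eR'; exists (map (vst_letter V) u), (map (vst_letter V) s).
- move=> n hn le r' c'; rewrite cell_fill; case: ifP => // _; by case: ifP.
Qed.

(** Dual to [vst_eP], with the row below in place of the row above and [estep] read backwards. *)
Lemma vst_fP :
  match vst_f i V with
  | Some V' => [/\ is_vst lam V', estep i (rd V') (rd V), cols V' = cols V &
                   forall n, i < n -> entries_le n V.1 -> entries_le n V'.1]
  | None => phi i (rd V) = 0
  end.
Proof.
rewrite /vst_f; have := rightmost_plusP (vst_letter V) i (buoys V).
case: rightmost_plus => [[r c] [lg iso]|] //=.
have [u [s [eb u0 s0]]] := iso.
have eR : rd V = map (vst_letter V) u ++ i :: map (vst_letter V) s.
  by rewrite /rd eb map_cat /= lg.
have bg : is_buoy V r c by rewrite -(mem_buoys plam vV) eb mem_cat mem_head orbT.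
have mb r' c' := mem_buoys plam vV r' c'.
have cl := buoy_in vV bg; have [ca nb ba ea] := anchorP plam vV cl.
set a := anchor V r c in ca nb ba ea *; rewrite /vst_letter /= in lg.
have row := ent_row vV; have col := ent_col plam vV.
have [/andP[ca' al]] := (ca).
case: ifPn => [/eqP eA|nA].
  have cl1 : c < nth 0 lam r.+1.
    by rewrite ltnNge; apply/negP; rewrite -(vst_shape1 vV) => /(cell_out 0); rewrite eA.
  (* A buoy there would be a - with no box read between it and [g], so nothing could cancel it. *)
  have nbc : ~~ is_buoy V r.+1 c.
    apply/negP => b; have [|||[r1 c1]] := isolated_minus iso (b := (r.+1, c)).
    - by rewrite mb.
    - by rewrite /rlt /=; lia.
    - exact: eA.
    by rewrite /rlt /= => -[_ _]; lia.
  have [c0 ec1] := nbuoy_left vV cl1 nbc.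
  have [|eR' eC] := rd_move plam vV eb _ cl1 nbc; first by rewrite eqxx.
  split=> //; last by rewrite eR eR' eA; exists (map (vst_letter V) u), (map (vst_letter V) s).
  apply: is_vst_move => //; apply/eqP; rewrite eqn_leq row ?leq_pred //= lg.
  (* The group containing the box below starts left of [c]. The + canceling its - lies in row [r] or
     higher, which gives row [r] an entry at least i in a column before [c]. *)
  have [c1 [hc1 b1 e1]] := buoy_left vV cl1.
  have c1c : c1 != c by apply: contraNneq nbc => <-.
  have [|||[r2 c2]] := isolated_minus iso (b := (r.+1, c1)).
  - by rewrite mb.
  - by rewrite /rlt /=; lia.
  - by rewrite /vst_letter /= e1 ?eA // leqnn.
  rewrite mb /rlt /vst_letter /= => -[b2 l2 h1 h2].
  have c2l := buoy_in vV b2; have ec2 : entry V.1 r.+1 c2 = i.+1 by rewrite e1 ?eA //; lia.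
  have [lt|gt|er] := ltngtP r2 r.+1.
  - have c2r : c2 < nth 0 lam r by lia.
    have : entry V.1 r2 c2 <= entry V.1 r c2.
      have [->//|lt2] : r2 = r \/ r2 < r by lia.
      exact/ltnW/col.
    rewrite l2 => /leq_trans; apply; apply: row; lia.
  - by have := col _ _ _ gt c2l; rewrite ec2; lia.
  - by move: l2; rewrite er ec2; lia.
have [eR' eC] := rd_recolor plam vV i.+1 eb.
have below c' : c <= c' -> c' < nth 0 lam r.+1 -> i.+1 < entry V.1 r.+1 c'.
  move=> h h1; apply: leq_trans (row _ _ _ h h1).
  have h2 : c < nth 0 lam r.+1 by lia.
  by have := col _ _ _ (ltnSn r) h2; move: nA; rewrite lg; clear; lia.
split=> //.
- apply: is_vst_recolor => //.
  + move=> r' c' h er; have h1 : c' < nth 0 lam r by lia.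
    have rr' : r' < r by rewrite er.
    by have := col _ _ _ rr' h1; rewrite ea // lg => /ltnW.
  + by move=> c' /andP[h _]; apply: below.
  + by move=> c0; apply: leqW; rewrite -lg; apply: row => //; apply: leq_pred.
  (* An i after the anchor would be a + read after [g]. Its - would lie in columns [c] to [a.+1],
     where rows up to [r] hold at most i and the rows below more than i+1. *)
  + rewrite -/a => h; rewrite leqNgt; apply/negP => lt.
    have ei : entry V.1 r a.+1 = i.
      by have := row _ _ _ (leqW ca') h; rewrite lg; move: lt; clear; lia.
    have [|||[r1 c1]] := isolated_plus iso (b := (r, a.+1)).
    * by rewrite mb ba.
    * by rewrite /rlt /=; lia.
    * exact: ei.
    rewrite mb /rlt /vst_letter /= => -[b1 l1 h1 h2].
    have c1l := buoy_in vV b1.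
    have [lt1|gt|er] := ltngtP r1 r.
    * have h3 : c1 < nth 0 lam r by move: h h1 h2; clear -lt1; lia.
      have h4 : c1 <= a.+1 by lia.
      have := col _ _ _ lt1 h3; have := row _ _ _ h4 h; rewrite l1 ei; clear; lia.
    * have h3 : c1 < nth 0 lam r.+1 := row_lt gt c1l.
      have h4 : c <= c1 by lia.
      have := below _ h4 h3; have : entry V.1 r.+1 c1 <= entry V.1 r1 c1.
        have [->//|lt2] : r1 = r.+1 \/ r.+1 < r1 by lia.
        exact/ltnW/col.
      by rewrite l1; clear; lia.
    * subst r1; have h4 : c1 <= a.+1 by lia.
      by have := row _ _ _ h4 h; rewrite l1 ei; clear; lia.
- by rewrite eR eR'; exists (map (vst_letter V) u), (map (vst_letter V) s).
- move=> n hn le r' c'; rewrite cell_fill; case: ifP => // _; by case: ifP.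
Qed.

Lemma eps0_buoys b : eps i (rd V) = 0 -> b \in buoys V -> vst_letter V b = i.+1 ->
  exists b', [/\ b' \in buoys V, vst_letter V b' = i & rlt b b'].
Proof.
move=> e0 bV lb; have := buoys_sorted V; move: e0; rewrite /rd.
case/splitPr: bV => u s; rewrite map_cat /= lb => /eps0_later/mapP[b' b's eb'].
rewrite (sorted_pairwise rlt_trans) pairwise_cat /= => /and4P[_ _ /allP h _].
by exists b'; rewrite mem_cat in_cons b's !orbT h.
Qed.

End Ops.

(** * Recovering a tableau from its word and columns *)

Lemma rd_pairs V : map (fun b => (vst_letter V b, b.2)) (buoys V) = zip (rd V) (cols V).
Proof. by rewrite /rd /cols zip_map. Qed.

Lemma colset_sub lam V V' r c : is_partition lam -> is_vst lam V -> is_vst lam V' ->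
  rd V = rd V' -> cols V = cols V' -> is_buoy V r c ->
  exists r', is_buoy V' r' c /\ entry V'.1 r' c = entry V.1 r c.
Proof.
move=> plam vV vV' eR eC b.
have : (entry V.1 r c, c) \in zip (rd V) (cols V).
  by rewrite -rd_pairs; apply/mapP; exists (r, c); rewrite ?(mem_buoys plam vV).
rewrite eR eC -rd_pairs => /mapP[[r' c']]; rewrite (mem_buoys plam vV') => b' [-> e].
by exists r'; rewrite e.
Qed.

(* The boxes of a column are recovered from the bottom: the entry of a box that
   is not a buoy is copied from its left, so it is too small for its letter
   to be skipped. *)
Lemma vst_inj_aux lam V V' r c : is_partition lam -> is_vst lam V -> is_vst lam V' ->
  rd V = rd V' -> cols V = cols V' ->
  (forall r', r < r' -> is_buoy V r' c = is_buoy V' r' c /\ entry V.1 r' c = entry V'.1 r' c) ->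
  (0 < c -> entry V.1 r c.-1 = entry V'.1 r c.-1) ->
  is_buoy V r c -> is_buoy V' r c /\ entry V.1 r c = entry V'.1 r c.
Proof.
move=> plam vV vV' eR eC below left b.
have cl := buoy_in vV b.
have [r' [b' e']] := colset_sub plam vV vV' eR eC b.
have [lt|gt|er] := ltngtP r' r; last by subst r'.
  have lt' := ent_col plam vV' lt cl.
  have [b2|nb] := boolP (is_buoy V' r c); last first.
    have [c0 e2] := nbuoy_left vV' cl nb.
    by have := ent_row vV (leq_pred c) cl; rewrite left // e2; lia.
  have [r2 [b3 e3]] := colset_sub plam vV' vV (esym eR) (esym eC) b2.
  have cl2 := buoy_in vV b3.
  have [lt2|gt2|er] := ltngtP r2 r.
  - by have := ent_col plam vV lt2 cl; lia.
  - by have := ent_col plam vV' gt2 cl2; have [_ <-] := below _ gt2; lia.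
  - by move: e3; rewrite er; lia.
have cl' := buoy_in vV' b'.
by have := ent_col plam vV gt cl'; have [_ ->] := below _ gt; lia.
Qed.

Lemma vst_inj lam V V' : is_partition lam -> is_vst lam V -> is_vst lam V' ->
  rd V = rd V' -> cols V = cols V' -> V = V'.
Proof.
move=> plam vV vV' eR eC.
suff H c r : is_buoy V r c = is_buoy V' r c /\ entry V.1 r c = entry V'.1 r c.
  have e1 : V.1 = V'.1.
    by apply: (@cell_inj _ 0) => [|r c _]; [rewrite (vst_shape1 vV) (vst_shape1 vV')|have [] := H c r].
  have e2 : V.2 = V'.2.
    by apply: (@cell_inj _ false) => [|r c _]; [rewrite (vst_shape2 vV) (vst_shape2 vV')|have [] := H c r].
  by case: V V' e1 e2 {eR eC H vV vV'} => [? ?] [? ?] /= -> ->.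
(* Within a column the induction goes upwards, [k] bounding the number of rows from [r'] on; the
   hypothesis is the agreement of the column on the left. *)
have step d : (0 < d -> forall r', entry V.1 r' d.-1 = entry V'.1 r' d.-1) ->
    forall k r', size lam - r' <= k ->
    is_buoy V r' d = is_buoy V' r' d /\ entry V.1 r' d = entry V'.1 r' d.
  move=> left; elim=> [|k IH] r' hk; case: (ltnP d (nth 0 lam r')) => cl; last 1 first.
  - by rewrite !cell_out ?(vst_shape1 vV) ?(vst_shape1 vV') ?(vst_shape2 vV) ?(vst_shape2 vV').
  - by exfalso; move: cl; rewrite nth_default //; lia.
  - by rewrite !cell_out ?(vst_shape1 vV) ?(vst_shape1 vV') ?(vst_shape2 vV) ?(vst_shape2 vV').
  have below r1 : r' < r1 ->
      is_buoy V r1 d = is_buoy V' r1 d /\ entry V.1 r1 d = entry V'.1 r1 d.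
    by move=> h; apply: IH; lia.
  have below' r1 : r' < r1 ->
      is_buoy V' r1 d = is_buoy V r1 d /\ entry V'.1 r1 d = entry V.1 r1 d.
    by move=> /below[-> ->].
  have [b|nb] := boolP (is_buoy V r' d).
    by have [->] := vst_inj_aux plam vV vV' eR eC below (fun h => left h r') b.
  have [b'|nb'] := boolP (is_buoy V' r' d).
    have left' h := esym (left h r').
    have [] := vst_inj_aux plam vV' vV (esym eR) (esym eC) below' left' b'.
    by rewrite (negbTE nb).
  have [d0 <-] := nbuoy_left vV cl nb; have [_ <-] := nbuoy_left vV' cl nb'.
  by rewrite left.
elim: c r => [|c IHc] r; apply: (step _ _ _ _ (leqnn _)) => // _ r' /=.
by have [] := IHc r'.
Qed.

(** If the last group of row [r] has an entry k+1 that is too large, its - needs a k read later.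
    Rows above have only smaller entries by induction, and in the remaining columns the rows below
    have larger ones, while row [r] itself has only k+1. *)
Lemma hw_entry lam n V : is_partition lam -> is_vst lam V -> entries_le n V.1 ->
  (forall i, 0 < i < n -> eps i (rd V) = 0) ->
  forall r c, c < nth 0 lam r -> entry V.1 r c = r.+1.
Proof.
move=> plam vV le hw r; elim/ltn_ind: r => r IH c cl.
have mb r' c' := mem_buoys plam vV r' c'.
set m := (nth 0 lam r).-1; have ml : m < nth 0 lam r by rewrite /m; lia.
apply/eqP; rewrite eqn_leq (ent_geS plam vV cl) andbT.
have cm : c <= m by rewrite /m; lia.
apply: leq_trans (ent_row vV cm ml) _; rewrite leqNgt; apply/negP => lt.
have [c0 [c0m b0 e0]] := buoy_left vV ml.
have [k ek] : exists k, entry V.1 r m = k.+1 by exists (entry V.1 r m).-1; lia.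
have kn : 0 < k < n by have := le r m; lia.
have [||[r1 c1]] := eps0_buoys (b := (r, c0)) (hw _ kn).
- by rewrite mb.
- by rewrite /vst_letter /= e0 ?ek // leqnn.
rewrite mb /vst_letter /rlt /= => -[b1 l1 h1]; have c1l := buoy_in vV b1.
have [lt1|gt|er] := ltngtP r1 r.
- by move: l1; rewrite IH //; lia.
- have c1r : c1 < nth 0 lam r := leq_trans c1l (partition_mono plam (ltnW gt)).
  have h3 : c0 <= c1 <= m by rewrite /m; lia.
  by have := ent_col plam vV gt c1l; rewrite e0 // ek l1; lia.
- rewrite er in l1 c1l; have h3 : c0 <= c1 <= m by rewrite /m; lia.
  by move: l1; rewrite e0 // ek; lia.
Qed.

Lemma vst_wtE V k : vst_wt V k = count_mem k.+1 (rd V).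
Proof. by rewrite /vst_wt /rd count_map; apply: eq_count => b. Qed.

(** All buoys with letter [k.+1] lie in row [k], so they are told apart by their columns. *)
Lemma hw_wt_le lam V : is_partition lam -> is_vst lam V ->
  (forall r c, c < nth 0 lam r -> entry V.1 r c = r.+1) ->
  forall k, vst_wt V k <= nth 0 lam k.
Proof.
move=> plam vV ent k; rewrite /vst_wt -size_filter.
set s := filter _ _; rewrite -[X in _ <= X](size_iota 0) -(size_map snd).
have hs b : b \in s -> b.1 = k /\ b.2 < nth 0 lam k.
  rewrite mem_filter; case: b => r c; rewrite (mem_buoys plam vV) => /andP[/eqP h b] /=.
  have cl := buoy_in vV b; move: h; rewrite /vst_letter /= ent // => -[<-] //.
apply: uniq_leq_size.
  rewrite map_inj_in_uniq.
    exact/filter_uniq/(sorted_uniq rlt_trans rlt_irr)/buoys_sorted.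
  by move=> [r c] [r' c'] /hs[/= -> _] /hs[/= -> _] ->.
by move=> c /mapP[b /hs[_ h] ->]; rewrite mem_iota.
Qed.

Lemma rd_letters lam n V : is_partition lam -> is_vst lam V -> entries_le n V.1 ->
  forall x, x \in rd V -> 0 < x <= n.
Proof.
move=> plam vV le x /mapP[[r c]]; rewrite (mem_buoys plam vV) => b ->.
by rewrite (ent_pos vV (buoy_in vV b)) le.
Qed.

Local Open Scope classical_set_scope.

(** * Crystals with a reading word *)

Definition embed (T : seq (seq nat)) : vtab := (T, fill (shape T) (fun _ _ => true)).

Section Embed.
Variables (mu : seq nat) (T : seq (seq nat)).
Hypothesis pmu : is_partition mu.

Lemma embed_buoy r c : is_buoy (embed T) r c = (c < nth 0 (shape T) r).
Proof. by rewrite cell_fill; case: ltnP. Qed.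

Lemma embed_buoys : buoys (embed T) = reading_order (shape T).
Proof.
rewrite /buoys /=; apply/all_filterP/allP => -[r c].
by rewrite mem_filter cell_fill => /andP[/= ->].
Qed.

Lemma embed_vst : is_ssyt mu T <-> is_vst mu (embed T).
Proof.
split=> [sT|[]//]; have shT : shape T = mu by case: sT.
split=> //=; first by rewrite shape_fill.
  by move=> r h; rewrite embed_buoy shT.
by move=> r c h _; rewrite embed_buoy shT.
Qed.

Hypothesis sT : is_ssyt mu T.
Let vT : is_vst mu (embed T). Proof. exact/embed_vst. Qed.
Let shT : shape T = mu. Proof. by case: sT. Qed.

Lemma embed_anchor r c : c < nth 0 mu r -> anchor (embed T) r c = c.
Proof.
move=> h; have [/andP[ca al] nb _ _] := anchorP pmu vT h.
apply/eqP; rewrite eqn_leq ca andbT leqNgt; apply/negP => lt.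
by have := nb c.+1; rewrite lt ltnSn embed_buoy shT => /(_ isT); lia.
Qed.

Lemma embed_recolor r c x : c < nth 0 mu r ->
  recolor (embed T) r c x = embed (ssyt_set T r c x).
Proof.
move=> h; rewrite /recolor /embed /ssyt_set shape_fill -/(embed T) embed_anchor //=.
congr pair; congr fill; apply: funext => r'; apply: funext => c'.
by rewrite -eqn_leq [c == c']eq_sym.
Qed.

(** A divider never moves: the i above [g] would be a buoy, hence a + read after [g] with no box
    between to cancel it. *)
Lemma embed_e i : vst_e i (embed T) = omap embed (ssyt_e i T).
Proof.
rewrite /vst_e /ssyt_e embed_buoys.
have := leftmost_minusP (vst_letter (embed T)) i (buoys (embed T)).
rewrite embed_buoys -[leftmost_minus (ssyt_letter T) _ _]/(leftmost_minus (vst_letter (embed T)) i _).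
case: leftmost_minus => [[r c] [lg iso]|] //=.
have cl : c < nth 0 mu r.
  rewrite -(mem_reading_order _ _ pmu) -shT; case: iso => u [s [-> _ _]].
  by rewrite mem_cat mem_head orbT.
rewrite embed_anchor // embed_recolor //; case: ifPn => // /andP[r0 /eqP eA].
rewrite -embed_buoys in iso.
have [|||[r1 c1]] := isolated_plus iso (b := (r.-1, c)).
- by rewrite (mem_buoys pmu vT) embed_buoy shT (leq_trans cl (partition_mono pmu (leq_pred r))).
- by rewrite /rlt /=; lia.
- exact: eA.
by rewrite /rlt /= => -[_ _]; lia.
Qed.

Lemma embed_f i : vst_f i (embed T) = omap embed (ssyt_f i T).
Proof.
rewrite /vst_f /ssyt_f embed_buoys.
have := rightmost_plusP (vst_letter (embed T)) i (buoys (embed T)).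
rewrite embed_buoys -[rightmost_plus (ssyt_letter T) _ _]/(rightmost_plus (vst_letter (embed T)) i _).
case: rightmost_plus => [[r c] [lg iso]|] //=.
have cl : c < nth 0 mu r.
  rewrite -(mem_reading_order _ _ pmu) -shT; case: iso => u [s [-> _ _]].
  by rewrite mem_cat mem_head orbT.
rewrite embed_recolor //; case: ifPn => // /eqP eA.
rewrite -embed_buoys in iso.
have cl1 : c < nth 0 mu r.+1.
  by rewrite ltnNge; apply/negP; rewrite -shT => /(cell_out 0); rewrite eA.
have [|||[r1 c1]] := isolated_minus iso (b := (r.+1, c)).
- by rewrite (mem_buoys pmu vT) embed_buoy shT.
- by rewrite /rlt /=; lia.
- exact: eA.
by rewrite /rlt /= => -[_ _]; lia.
Qed.

Lemma perm_flatten_rd : perm_eq (flatten T) (rd (embed T)).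
Proof.
rewrite /rd embed_buoys.
have -> : flatten T = map (ssyt_letter T)
    [seq (r, c) | r <- iota 0 (size T), c <- iota 0 (size (nth [::] T r))].
  rewrite map_flatten -map_comp; congr flatten; rewrite -[LHS](mkseq_nth [::]).
  by apply: eq_map => r /=; rewrite -map_comp -[LHS](mkseq_nth 0).
apply: perm_map; apply: uniq_perm.
- apply: allpairs_uniq_dep; rewrite ?iota_uniq //.
    by move=> x _; apply: iota_uniq.
  by move=> [r c] [r' c'] _ _ [-> ->].
- exact: (sorted_uniq rlt_trans rlt_irr (reading_order_sorted (shape T))).
move=> [r c]; rewrite shT mem_reading_order // -shT nth_shape.
apply/allpairsPdep/idP => [[r' [c' [_ + [-> ->]]]]|h].
  by rewrite mem_iota.
exists r, c; rewrite !mem_iota /= add0n; split=> //.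
by rewrite ltnNge; apply/negP => h'; rewrite nth_default in h.
Qed.

Lemma content_rd k : content T k = count_mem k.+1 (rd (embed T)).
Proof. exact: (permP perm_flatten_rd). Qed.

End Embed.

(* What is used of a crystal: it is sent to words by a map rdB that intertwines
   the operators, and which is injective once the invariant inv is known. *)
Definition model (n : nat) (B : crystal) (rdB inv : elt B -> seq nat) : Prop :=
  [/\ forall i b, 0 < i < n -> carrier b ->
        match ce i b with
        | Some b' => [/\ carrier b', estep i (rdB b) (rdB b') & inv b' = inv b]
        | None => eps i (rdB b) = 0
        end,
      forall i b, 0 < i < n -> carrier b ->
        match cf i b with
        | Some b' => [/\ carrier b', estep i (rdB b') (rdB b) & inv b' = inv b]
        | None => phi i (rdB b) = 0
        end,
      forall b b', carrier b -> carrier b' -> rdB b = rdB b' -> inv b = inv b' -> b = b' &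
      forall b x, carrier b -> x \in rdB b -> 0 < x <= n].

Lemma model_VST n lam : is_partition lam -> model (B := VST n lam) n rd cols.
Proof.
move=> plam; split.
- move=> i V /andP[i0 ni] /= [vV le]; have := vst_eP plam vV i0.
  by case: vst_e => // V' [vV' eE eC h]; split=> //; split=> //; apply: h => //; apply: ltnW.
- move=> i V /andP[i0 ni] /= [vV le]; have := vst_fP plam vV i0.
  by case: vst_f => // V' [vV' eE eC h]; split=> //; split=> //; apply: h.
- by move=> V V' /= [vV _] [vV' _]; apply: (vst_inj plam vV vV').
by move=> V x /= [vV le]; apply: (rd_letters plam vV).
Qed.

Lemma model_B n mu : is_partition mu ->
  model (B := Bcrystal n mu) n (rd \o embed) (cols \o embed).
Proof.
move=> pmu; split.
- move=> i T /andP[i0 ni] /= [sT le].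
  have := vst_eP pmu ((embed_vst mu T).1 sT) i0; rewrite (embed_e pmu) //.
  case: ssyt_e => //= T' [/embed_vst sT' eE eC h]; split=> //; split=> //.
  by apply: h => //; apply: ltnW.
- move=> i T /andP[i0 ni] /= [sT le].
  have := vst_fP pmu ((embed_vst mu T).1 sT) i0; rewrite (embed_f pmu) //.
  case: ssyt_f => //= T' [/embed_vst sT' eE eC h]; split=> //; split=> //.
  by apply: h.
- move=> T T' /= [/embed_vst vT _] [/embed_vst vT' _] eR eC.
  by have [] := vst_inj pmu vT vT' eR eC.
by move=> T x /= [/embed_vst vT le]; apply: (rd_letters pmu vT).
Qed.

Lemma eps_notin i w : i.+1 \notin w -> eps i w = 0.
Proof.
elim: w => //= x w IH; rewrite in_cons negb_or => /andP[ne /IH e].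
by rewrite /sgm /sgl /= e eq_sym (negbTE ne).
Qed.

Lemma qshapes_shape w w' : qshapes w = qshapes w' -> shape (ptab w) = shape (ptab w').
Proof. by case: w w' => [|y w] [|y' w'] //= []. Qed.

Section Model.
Variables (n : nat) (B : crystal) (rdB inv : elt B -> seq nat).
Hypothesis mB : model n rdB inv.

Definition is_hw (b : elt B) : Prop := forall i, 0 < i < n -> eps i (rdB b) = 0.
(* Separates the components, by hw_unique and climb. *)
Definition cls (b : elt B) := (inv b, qshapes (rdB b)).

Lemma is_hw_word b : carrier b -> is_hw b -> hwword (rdB b).
Proof.
case: mB => _ _ _ let_ cb hw; split.
  by apply/negP => /(let_ _ _ cb).
(* From i = n on, the letter i+1 does not occur. *)
move=> i i0; have [lt|le] := ltnP i n; first by apply: hw; rewrite i0.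
by apply: eps_notin; apply/negP => /(let_ _ _ cb); lia.
Qed.

Lemma cls_inj b b' : carrier b -> carrier b' -> cls b = cls b' ->
  ptab (rdB b) = ptab (rdB b') -> b = b'.
Proof.
by case: mB => _ _ inj _ cb cb' [eI eQ] eP; apply: inj => //; apply: pq_inj.
Qed.

(** Equal successive shapes give P of equal shape, and a superstandard tableau is determined by its
    shape. *)
Lemma hw_unique b b' : carrier b -> carrier b' -> is_hw b -> is_hw b' ->
  cls b = cls b' -> b = b'.
Proof.
move=> cb cb' hb hb' e; apply: cls_inj => //.
case: e => _ eQ; apply: ptab_hw_shape; try exact: is_hw_word.
exact: qshapes_shape.
Qed.

Lemma ce_cls i b b' : 0 < i < n -> carrier b -> ce i b = Some b' ->
  carrier b' /\ cls b' = cls b.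
Proof.
case: mB => he _ _ _ hi cb e; have := he _ _ hi cb; rewrite e => -[cb' eE eI].
by split=> //; rewrite /cls eI; have [_ _ ->] := ptab_estep eE.
Qed.

Lemma cf_cls i b b' : 0 < i < n -> carrier b -> cf i b = Some b' ->
  carrier b' /\ cls b' = cls b.
Proof.
case: mB => _ hf _ _ hi cb e; have := hf _ _ hi cb; rewrite e => -[cb' eE eI].
by split=> //; rewrite /cls eI; have [_ _ ->] := ptab_estep eE.
Qed.

End Model.

Section Bisim.
Variables (n : nat) (B C : crystal).
Variables (rdB invB : elt B -> seq nat) (rdC invC : elt C -> seq nat).
Hypotheses (mB : model n rdB invB) (mC : model n rdC invC).

(** By [ptab_estep], P(b) alone tells whether e_i vanishes and what P becomes: the shape stays, and
    the column word undergoes e_i. *)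
Lemma bisim_e i b c : 0 < i < n -> carrier b -> carrier c ->
  ptab (rdB b) = ptab (rdC c) ->
  match ce i b with
  | Some b' => exists c', ce i c = Some c' /\ ptab (rdB b') = ptab (rdC c')
  | None => ce i c = None
  end.
Proof.
case: mB mC => he _ _ _ [he' _ _ _] hi cb cc eP.
have := he _ _ hi cb; have := he' _ _ hi cc.
have eS : eps i (rdB b) = eps i (rdC c) by rewrite -ptab_sg eP ptab_sg.
case: (ce i b) => [b'|]; case: (ce i c) => [c'|] //; rewrite -?eS.
- move=> [_ /ptab_estep[e1 s1 _] _] [_ /ptab_estep[e2 s2 _] _]; exists c'; split=> //.
  rewrite eP in e2 s2; apply: colword_inj; first by rewrite -s1 -s2.
  exact: estep_fun e2 e1.
- by move=> e0 [_ /sg_estep[_]]; rewrite e0.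
by move=> [_ /sg_estep[_ +] _] e0; rewrite -eS e0.
Qed.

Lemma bisim_f i b c : 0 < i < n -> carrier b -> carrier c ->
  ptab (rdB b) = ptab (rdC c) ->
  match cf i b with
  | Some b' => exists c', cf i c = Some c' /\ ptab (rdB b') = ptab (rdC c')
  | None => cf i c = None
  end.
Proof.
case: mB mC => _ he _ _ [_ he' _ _] hi cb cc eP.
have := he _ _ hi cb; have := he' _ _ hi cc.
have eS : phi i (rdB b) = phi i (rdC c) by rewrite -ptab_sg eP ptab_sg.
case: (cf i b) => [b'|]; case: (cf i c) => [c'|] //; rewrite -?eS.
- move=> [_ /ptab_estep[e1 s1 _] _] [_ /ptab_estep[e2 s2 _] _]; exists c'; split=> //.
  rewrite eP in e2 s2; apply: colword_inj; first by rewrite s1 s2.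
  exact: estep_inj e2 e1.
- by move=> e0 [_ /sg_estep[+ _]]; rewrite e0.
by move=> [_ /sg_estep[+ _] _] e0; rewrite -eS e0.
Qed.

End Bisim.

Lemma sumn_estep i w w' : estep i w w' -> sumn w' < sumn w.
Proof. by case=> u [s [-> -> _ _]]; rewrite !sumn_cat /= ; lia. Qed.

(** Induction on the sum of the letters, which e_i lowers. The path from [b] up to [b0] is retraced
    from [c0] by f_i, which does not vanish because phi_i depends only on P. Since [C] is arbitrary,
    this transports elements from tableaux to valued-set tableaux and back. *)
Lemma climb n B (rdB invB : elt B -> seq nat) : model n rdB invB ->
  forall b, carrier b -> exists b0,
  [/\ carrier b0, is_hw n rdB b0, cls rdB invB b0 = cls rdB invB b &
   forall C (rdC invC : elt C -> seq nat), model n rdC invC ->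
   forall c0, carrier c0 -> ptab (rdC c0) = ptab (rdB b0) ->
   exists c, [/\ carrier c, ptab (rdC c) = ptab (rdB b) &
                 cls rdC invC c = cls rdC invC c0]].
Proof.
move=> mB b; have [k] := ubnP (sumn (rdB b)); elim: k b => // k IH b hk cb.
have [hw|/existsNP[i]] := pselect (is_hw n rdB b).
  by exists b; split=> // C rdC invC _ c0 cc0 e; exists c0.
move=> /not_implyP[hi ne]; have [he _ _ _] := mB; have := he _ _ hi cb.
case eb: (ce i b) => [b'|//] [cb' eE eI].
have [|b0 [cb0 hw0 cl0 h0]] := IH b' _ cb'.
  by have := sumn_estep eE; lia.
exists b0; split=> //.
  by rewrite cl0; have [_ ->] := ce_cls mB hi cb eb.
move=> C rdC invC mC c0 cc0 e0; have [c' [cc' ec' clc']] := h0 _ _ _ mC _ cc0 e0.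
have [e1 s1 _] := ptab_estep eE.
have [_ hf _ _] := mC; have := hf _ _ hi cc'; case ec: (cf i c') => [c|].
  move=> [cc eE' eI']; have [e2 s2 _] := ptab_estep eE'; exists c; split=> //; last first.
    by rewrite -clc'; have [_ ->] := cf_cls mC hi cc' ec.
  rewrite ec' in e2 s2; apply: colword_inj; first by rewrite s1 s2.
  exact: estep_inj e2 e1.
by have [+ _] := sg_estep e1; rewrite -ec' !ptab_sg => -> .
Qed.

(** * The isomorphism *)

Lemma weight_partition (m : nat -> nat) n : (forall k, m k.+1 <= m k) ->
  (forall k, n <= k -> m k = 0) -> exists mu, is_partition mu /\ m = nth 0 mu.
Proof.
move=> mono m0; have ex : exists k, m k == 0 by exists n; rewrite m0.
case: (ex_minnP ex) => h /eqP mh hmin; exists (mkseq m h).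
have lt k : k < h -> m k != 0 by move=> kh; apply: contraTneq kh => /eqP/hmin; rewrite leqNgt.
split.
  apply/andP; split.
    apply/(sortedP 0) => k; rewrite size_mkseq => hk.
    by rewrite /= !nth_mkseq //; lia.
  by apply/negP => /mapP[k]; rewrite mem_iota => hk /esym/eqP; apply/negP/lt.
apply: funext => k; case: (ltnP k h) => hk; first by rewrite nth_mkseq.
rewrite nth_default ?size_mkseq //; elim: k hk => [|k IH] hk.
  by move: hk mh; rewrite leqn0 => /eqP ->.
move: hk; rewrite leq_eqVlt => /orP[/eqP <- //|/IH e].
by have := mono k; rewrite e; lia.
Qed.

Lemma partition_nth_inj mu nu : is_partition mu -> is_partition nu ->
  nth 0 mu = nth 0 nu -> mu = nu.
Proof.
by move=> /andP[_ h] /andP[_ h'] e; apply: nth0_inj => // k; rewrite e.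
Qed.

Definition superstandard (mu : seq nat) : seq (seq nat) := fill mu (fun r _ => r.+1).

Section Superstandard.
Variables (n : nat) (mu : seq nat).
Hypothesis pmu : is_partition mu.

Lemma superstandard_ssyt : is_ssyt mu (superstandard mu).
Proof.
have ent r c : c < nth 0 mu r -> entry (superstandard mu) r c = r.+1.
  by move=> h; rewrite cell_fill h.
split.
- by rewrite shape_fill.
- by move=> r c h; rewrite ent.
- by move=> r c h; rewrite !ent //; lia.
move=> r c h; rewrite !ent //; exact: leq_trans h (partition_mono pmu _).
Qed.

Lemma superstandard_le : size mu <= n -> entries_le n (superstandard mu).
Proof.
move=> h r c; rewrite cell_fill; case: ltnP => // h1.
by apply: leq_trans h; rewrite ltnNge; apply/negP => h2; rewrite nth_default in h1.
Qed.

Lemma superstandard_hw : is_hw (B := Bcrystal n mu) n (rd \o embed) (superstandard mu).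
Proof.
move=> i /andP[i0 _]; have vT := (embed_vst _ _).1 superstandard_ssyt.
have ent r c : c < nth 0 mu r -> entry (superstandard mu) r c = r.+1.
  by move=> h; rewrite cell_fill h.
have sh : shape (superstandard mu) = mu by rewrite shape_fill.
have := leftmost_minusP (vst_letter (embed (superstandard mu))) i (buoys (embed (superstandard mu))).
case: leftmost_minus => [[r c] [lg iso]|//].
have bg : is_buoy (embed (superstandard mu)) r c.
  by rewrite -(mem_buoys pmu vT); case: iso => u [s [-> _ _]]; rewrite mem_cat mem_head orbT.
have cl := buoy_in vT bg; move: lg; rewrite /vst_letter /= ent // => -[er]; subst r.
have cl1 : c < nth 0 mu i.-1 := leq_trans cl (partition_mono pmu (leq_pred i)).
have [|||[r1 c1]] := isolated_plus iso (b := (i.-1, c)).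
- by rewrite (mem_buoys pmu vT) embed_buoy sh.
- by rewrite /rlt /=; lia.
- by rewrite /vst_letter /= ent //; lia.
by rewrite /rlt /= => -[_ _]; lia.
Qed.

(** With [climb], this puts all of B(mu) in a single class. *)
Lemma superstandard_unique T : is_ssyt mu T -> entries_le n T ->
  is_hw (B := Bcrystal n mu) n (rd \o embed) T -> T = superstandard mu.
Proof.
move=> sT le hw; have vT := (embed_vst _ _).1 sT.
have sh : shape T = mu by case: sT.
apply: (@cell_inj _ 0); first by rewrite shape_fill.
move=> r c; rewrite sh => h; rewrite cell_fill h.
exact: (hw_entry pmu vT le hw h).
Qed.

Lemma content_superstandard : content (superstandard mu) = nth 0 mu.
Proof.
apply: funext => k; rewrite /content count_flatten sumnE big_map big_map.
have cnt r : count (pred1 k.+1) (mkseq (fun=> r.+1) (nth 0 mu r)) = (r == k) * nth 0 mu r.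
  rewrite count_map; case: eqVneq => [->|ne].
    by rewrite mul1n -[RHS](size_iota 0); apply/eqP; rewrite -all_count; apply/allP => x /=.
  by rewrite mul0n; apply/eqP; rewrite -leqn0 leqNgt -has_count; apply/hasP => -[x _ /=]; rewrite eqSS (negbTE ne).
under eq_bigr do rewrite cnt.
case: (ltnP k (size mu)) => h.
  rewrite (bigD1_seq k) ?iota_uniq ?mem_iota //= eqxx mul1n big1 ?addn0 // => r /negbTE ->.
  by rewrite mul0n.
rewrite nth_default // big1_seq // => r; rewrite mem_iota => /andP[_] hr.
by have /negbTE -> : r != k by lia.
Qed.

End Superstandard.

Section Iso.
Variables (n : nat) (lam : seq nat).
Hypothesis plam : is_partition lam.

Notation X := (VST n lam).
Notation hwV := (is_hw (B := X) n rd).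
Notation clV := (cls (B := X) rd cols).
Notation clT mu := (cls (B := Bcrystal n mu) (rd \o embed) (cols \o embed)).
Let mX := model_VST n plam.

Lemma highest_weightP (V : vtab) : @carrier X V -> highest_weight n V <-> hwV V.
Proof.
move=> cV; have [he _ _ _] := mX.
split=> h i hi; have := he _ _ hi cV; have := h _ hi.
  by move=> e; rewrite [ce _ _]e.
move=> e; case e': (vst_e i V) => [V'|//]; rewrite [ce _ _]e' => -[_ /sg_estep[_ +] _].
by rewrite e.
Qed.

Lemma hw_weight (V : vtab) : @carrier X V -> hwV V ->
  exists mu, subpartitions lam mu /\ vst_wt V = nth 0 mu.
Proof.
move=> [vV le] hw; have ent := hw_entry plam vV le hw.
have [||mu [pmu e]] := @weight_partition (vst_wt V) n.
- move=> k; rewrite !vst_wtE; have [lt|ge] := ltnP k.+1 n.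
    have := count_sg k.+1 (rd V); rewrite (hw k.+1) //.
    by move: (count_mem _ _) (count_mem _ _) => a b; lia.
  suff -> : count_mem k.+2 (rd V) = 0 by [].
  by apply/count_memPn/negP => /(rd_letters plam vV le); lia.
- move=> k nk; rewrite vst_wtE.
  by apply/count_memPn/negP => /(rd_letters plam vV le); lia.
exists mu; split=> //; split=> // r; rewrite -e; exact: hw_wt_le.
Qed.

(** Here and below the default values of [xget] are never taken on the carrier, as [vtopP], [vmuP]
    and [vssytP] show. *)
Definition vtop (V : vtab) : vtab :=
  xget V [set H | [/\ @carrier X H, hwV H & clV H = clV V]].

Definition vmu (V : vtab) : seq nat :=
  xget [::] [set mu | is_partition mu /\ vst_wt (vtop V) = nth 0 mu].

Definition vidx (V : vtab) : nat :=
  index (vtop V) (fset_set (hw_elements n lam (vmu V))).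

Definition vssyt (V : vtab) : seq (seq nat) :=
  xget [::] [set T | @carrier (Bcrystal n (vmu V)) T /\ ptab (rd (embed T)) = ptab (rd V)].

Lemma vtopP V : @carrier X V ->
  [/\ @carrier X (vtop V), hwV (vtop V) & clV (vtop V) = clV V].
Proof.
move=> cV; have [H [cH hH eH _]] := climb mX cV.
by apply: (@xgetPex _ V [set H | [/\ @carrier X H, hwV H & clV H = clV V]]); exists H.
Qed.

Lemma vtop_unique V H : @carrier X V -> @carrier X H -> hwV H -> clV H = clV V ->
  vtop V = H.
Proof.
move=> cV cH hH eH; have [c h e] := vtopP cV.
by apply: (hw_unique mX) => //; rewrite e eH.
Qed.

Lemma vmuP V : @carrier X V ->
  [/\ subpartitions lam (vmu V), is_partition (vmu V) & vst_wt (vtop V) = nth 0 (vmu V)].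
Proof.
move=> cV; have [c h _] := vtopP cV; have [mu [smu e]] := hw_weight c h.
have [p e'] : is_partition (vmu V) /\ vst_wt (vtop V) = nth 0 (vmu V).
  apply: (@xgetPex _ [::] [set mu | is_partition mu /\ vst_wt (vtop V) = nth 0 mu]).
  by exists mu; split=> //; case: smu.
by split=> //; split=> // r; rewrite -e' e; case: smu.
Qed.

Lemma vmu_unique V mu : @carrier X V -> is_partition mu ->
  vst_wt (vtop V) = nth 0 mu -> vmu V = mu.
Proof.
by move=> cV pmu e; have [_ p e'] := vmuP cV; apply: partition_nth_inj => //; rewrite -e'.
Qed.

Lemma hw_mem V mu : @carrier X V -> hwV V -> vst_wt V = nth 0 mu ->
  V \in fset_set (hw_elements n lam mu).
Proof.
move=> cV hV e; rewrite in_fset_set; last exact: finite_hw_elements.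
rewrite inE; case: (cV) => vV le; split=> //; exact/highest_weightP.
Qed.

Lemma vtop_mem V : @carrier X V -> vtop V \in fset_set (hw_elements n lam (vmu V)).
Proof. by move=> cV; have [_ _ e] := vmuP cV; have [c h _] := vtopP cV; apply: hw_mem. Qed.

Lemma size_mu_le V mu : @carrier X V -> is_partition mu -> vst_wt V = nth 0 mu -> size mu <= n.
Proof.
move=> [vV le] /andP[_ m0] e; rewrite leqNgt; apply/negP => lt.
have : vst_wt V n = 0.
  by rewrite vst_wtE; apply/count_memPn/negP => /(rd_letters plam vV le); lia.
by rewrite e => e0; move: m0; rewrite -e0 mem_nth.
Qed.

(** The superstandard tableau and [vtop V] have highest weight words of the same content, hence the
    same P; the path from [V] to its top can thus be retraced from the superstandard tableau. *)
Lemma vssytP V : @carrier X V ->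
  @carrier (Bcrystal n (vmu V)) (vssyt V) /\ ptab (rd (embed (vssyt V))) = ptab (rd V).
Proof.
move=> cV; have [smu pmu emu] := vmuP cV; have [cT hT eT] := vtopP cV.
have [H [cH hH eH hC]] := climb mX cV.
rewrite -(vtop_unique cV cH hH eH) in hC.
have cS : @carrier (Bcrystal n (vmu V)) (superstandard (vmu V)).
  split; first exact: superstandard_ssyt.
  (* No letter exceeds [n], so the weight has at most [n] parts and the superstandard tableau fits
     in B(mu). *)
  by apply: superstandard_le; apply: size_mu_le cT pmu emu.
have [|T [h1 h2 _]] := hC _ _ _ (model_B n pmu) _ cS.
  apply: ptab_hw_content.
  - exact: (is_hw_word (model_B n pmu) cS (superstandard_hw (n := n) pmu)).
  - exact: (is_hw_word mX cT hT).
  move=> k; rewrite -vst_wtE emu -(content_superstandard pmu) (content_rd pmu) //.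
  exact: superstandard_ssyt.
by apply: (@xgetPex _ [::] [set T | @carrier (Bcrystal n (vmu V)) T /\
  ptab (rd (embed T)) = ptab (rd V)]); exists T.
Qed.

Lemma ssyt_cls mu T : is_partition mu -> @carrier (Bcrystal n mu) T ->
  clT mu T = clT mu (superstandard mu) /\
  forall C (rdC invC : elt C -> seq nat), model n rdC invC ->
   forall c0, carrier c0 -> ptab (rdC c0) = ptab (rd (embed (superstandard mu))) ->
   exists c, [/\ carrier c, ptab (rdC c) = ptab (rd (embed T)) &
                 cls rdC invC c = cls rdC invC c0].
Proof.
move=> pmu cT; have [T0 [[sT0 le0] h0 e0 hC]] := climb (model_B n pmu) cT.
by have eT0 := superstandard_unique pmu sT0 le0 h0; rewrite -e0 -eT0.
Qed.

(** The tableaux of shape [mu] form one class, so within it P alone separates them. *)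
Lemma ssyt_ptab_inj mu T T' : is_partition mu -> @carrier (Bcrystal n mu) T ->
  @carrier (Bcrystal n mu) T' -> ptab (rd (embed T)) = ptab (rd (embed T')) -> T = T'.
Proof.
move=> pmu cT cT' e; apply: (cls_inj (model_B n pmu)) => //.
by have [-> _] := ssyt_cls pmu cT; have [-> _] := ssyt_cls pmu cT'.
Qed.

Lemma vssyt_unique V T : @carrier X V -> @carrier (Bcrystal n (vmu V)) T ->
  ptab (rd (embed T)) = ptab (rd V) -> vssyt V = T.
Proof.
move=> cV cT e; have [_ pmu _] := vmuP cV; have [cS eS] := vssytP cV.
by apply: (ssyt_ptab_inj pmu) => //; rewrite eS e.
Qed.

Lemma vst_data_cls V V' : @carrier X V -> @carrier X V' -> clV V' = clV V ->
  [/\ vtop V' = vtop V, vmu V' = vmu V & vidx V' = vidx V].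
Proof.
move=> cV cV' e; have [c h eT] := vtopP cV.
have et : vtop V' = vtop V by apply: vtop_unique => //; rewrite e.
by rewrite /vidx /vmu et.
Qed.

Notation Y := (crystal_sum (subpartitions lam)
  (fun mu => crystal_copies (hw_mult n lam mu) (Bcrystal n mu))).

Definition triple (mu : seq nat) (k : nat) (T : seq (seq nat)) : elt Y :=
  existT (fun mu => elt (crystal_copies (hw_mult n lam mu) (Bcrystal n mu))) mu
    (existT (fun=> elt (Bcrystal n mu)) k T).

Definition vst_iso (V : vtab) : elt Y := triple (vmu V) (vidx V) (vssyt V).

Lemma vst_iso_bij : set_bij (@carrier X) (@carrier Y) vst_iso.
Proof.
split.
- move=> V cV; have [smu _ _] := vmuP cV; have [cT _] := vssytP cV.
  by split=> //; split=> //=; rewrite /vidx /hw_mult index_mem; apply: vtop_mem.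
- move=> V V' /set_mem cV /set_mem cV' e.
  have em : vmu V = vmu V' by have := congr1 (fun x : elt Y => projT1 x) e.
  have ek : vidx V = vidx V' by have := congr1 (fun x : elt Y => projT1 (projT2 x)) e.
  have eT : vssyt V = vssyt V'.
    by have := congr1 (fun x : elt Y => projT2 (projT2 x) : seq (seq nat)) e.
  (* The weight and the index recover the highest weight element, hence the class; the tableau
     recovers P. *)
  have et : vtop V = vtop V'.
    rewrite -(nth_index V (vtop_mem cV)) -(nth_index V (vtop_mem cV')).
    by move: ek; rewrite /vidx -em => ->.
  have [_ _ c1] := vtopP cV; have [_ _ c2] := vtopP cV'.
  have [_ p1] := vssytP cV; have [_ p2] := vssytP cV'.
  by apply: (cls_inj mX) => //; rewrite -?c1 -?c2 ?et // -p1 -p2 eT.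
move=> [mu [k T]] [/= smu [/= kmu cT]]; have pmu : is_partition mu by case: smu.
set H := nth ([::], [::]) (fset_set (hw_elements n lam mu)) k.
have : H \in fset_set (hw_elements n lam mu) by apply: mem_nth.
rewrite in_fset_set; last exact: finite_hw_elements.
move=> /set_mem[vH leH hH wH].
have cH : @carrier X H by [].
have {}hH : hwV H by apply/highest_weightP.
have cS : @carrier (Bcrystal n mu) (superstandard mu).
  split; first exact: superstandard_ssyt.
  by apply: superstandard_le; apply: size_mu_le cH pmu wH.
(* The path from the superstandard tableau down to [T] is copied from [H], which has the same P, and
   ends in the required [V]. *)
have [_ hC] := ssyt_cls pmu cT.
have [|V [cV eV clVH]] := hC _ _ _ mX _ cH.
  apply: ptab_hw_content.
  - exact: (is_hw_word mX cH hH).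
  - exact: (is_hw_word (model_B n pmu) cS (superstandard_hw (n := n) pmu)).
  move=> l; rewrite -vst_wtE wH -(content_superstandard pmu) (content_rd pmu) //.
  exact: superstandard_ssyt.
have et : vtop V = H by apply: vtop_unique.
have em : vmu V = mu by apply: vmu_unique; rewrite ?et.
exists V => //; rewrite /vst_iso em (_ : vidx V = k); last first.
  by rewrite /vidx et em /H index_uniq // fset_uniq.
by rewrite (_ : vssyt V = T) //; apply: vssyt_unique; rewrite ?em.
Qed.

Lemma vst_iso_wt V : @carrier X V -> cwt (vst_iso V) = vst_wt V.
Proof.
move=> cV; have [_ pmu _] := vmuP cV; have [[sT _] e] := vssytP cV.
apply: funext => k; rewrite vst_wtE [LHS](content_rd pmu sT).
by apply/permP; rewrite -(permPl (perm_ptab _)) e perm_ptab.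
Qed.

Lemma vst_crystal_iso : crystal_iso n X Y.
Proof.
exists vst_iso; split; [exact: vst_iso_bij|exact: vst_iso_wt|].
move=> i hi; split=> V cV; have [_ pmu _] := vmuP cV; have [cT eT] := vssytP cV.
  have := bisim_e mX (model_B n pmu) hi cV cT (esym eT).
  case eV: (ce i V) => [V'|]; last by move=> e; rewrite /= [ssyt_e _ _]e.
  case=> T' [e1 e2]; have [cV' cl'] := ce_cls mX hi cV eV; split=> //.
  have [_ em ek] := vst_data_cls cV cV' cl'.
  have [cT' _] := ce_cls (model_B n pmu) hi cT e1.
  rewrite /= [ssyt_e _ _]e1 /= /vst_iso em ek (_ : vssyt V' = T') //.
  by apply: vssyt_unique; rewrite ?em.
have := bisim_f mX (model_B n pmu) hi cV cT (esym eT).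
case eV: (cf i V) => [V'|]; last by move=> e; rewrite /= [ssyt_f _ _]e.
case=> T' [e1 e2]; have [cV' cl'] := cf_cls mX hi cV eV; split=> //.
have [_ em ek] := vst_data_cls cV cV' cl'.
have [cT' _] := cf_cls (model_B n pmu) hi cT e1.
rewrite /= [ssyt_f _ _]e1 /= /vst_iso em ek (_ : vssyt V' = T') //.
by apply: vssyt_unique; rewrite ?em.
Qed.

End Iso.

(** * Generating series *)

Lemma entry_support (T : seq (seq nat)) r c k : entry T r c = k.+1 -> c < nth 0 (shape T) r.
Proof. by move=> e; rewrite ltnNge; apply/negP => /(cell_out 0); rewrite e. Qed.

Lemma vst_wt_bounded lam (V : vtab) n : is_partition lam -> is_vst lam V ->
  (forall k, n <= k -> vst_wt V k = 0) -> entries_le n V.1.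
Proof.
move=> plam vV h r c; case e: (entry V.1 r c) => [//|k].
have cl := entry_support e; rewrite (vst_shape1 vV) in cl.
rewrite leqNgt; apply/negP; rewrite ltnS => /h e0.
by have := vst_wt_gt0 plam vV cl e; rewrite e0.
Qed.

Lemma content_bounded (T : seq (seq nat)) n :
  (forall k, n <= k -> content T k = 0) -> entries_le n T.
Proof.
move=> h r c; case e: (entry T r c) => [//|k].
have : 0 < content T k by rewrite -has_count has_pred1 -e mem_entry // (entry_support e).
by move=> k0; rewrite leqNgt; apply/negP; rewrite ltnS => /h e0; rewrite e0 in k0.
Qed.

(** Insertion keeps the number of letters. This makes the exponent of alpha constant on a
    component. *)
Lemma size_vst_ssyt n lam V : is_partition lam -> @carrier (VST n lam) V ->
  ngroups V = sumn (vmu n lam V).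
Proof.
move=> plam cV; have [_ pmu _] := vmuP plam cV; have [[sT _] e] := vssytP plam cV.
have shT : shape (vssyt n lam V) = vmu n lam V by case: sT.
rewrite -[in RHS]shT -size_flatten (perm_size (perm_flatten_rd pmu sT)).
rewrite /ngroups -(size_map (vst_letter V)) -/(rd V).
by rewrite -(perm_size (perm_ptab (rd V))) -e (perm_size (perm_ptab _)).
Qed.

Section Fiber.
Variables (n : nat) (lam : seq nat) (m : nat -> nat).
Hypotheses (plam : is_partition lam) (mn : forall k, n <= k -> m k = 0).
Notation A := [set V : vtab | is_vst lam V /\ vst_wt V = m].
Notation TT mu := [set T | is_ssyt mu T /\ content T = m].

Lemma fiber_carrier V : A V -> @carrier (VST n lam) V.
Proof. by move=> [vV eV]; split=> //; apply: (vst_wt_bounded plam vV) => k /mn; rewrite eV. Qed.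

(** The isomorphism preserves weights, so it restricts to the tableaux of weight [m]: those of type
    [mu] match the pairs of a copy of B(mu) and a tableau of content [m]. *)
Lemma fiber_card mu : subpartitions lam mu ->
  count (fun V => vmu n lam V == mu) (fset_set A) =
  hw_mult n lam mu * size (fset_set (TT mu)).
Proof.
move=> smu; have pmu : is_partition mu by case: smu.
have finA : finite_set A by apply: finite_vst_wt.
have finT : finite_set (TT mu) by apply: finite_ssyt_content.
have [_ inj surj] := vst_iso_bij n plam.
rewrite -size_filter -(size_map (fun V => (vidx n lam V, vssyt n lam V))).
have <- : size [seq (k, T) | k <- iota 0 (hw_mult n lam mu), T <- fset_set (TT mu)] =
    hw_mult n lam mu * size (fset_set (TT mu)) by rewrite size_allpairs size_iota.
apply: perm_size; apply: uniq_perm.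
- rewrite map_inj_in_uniq ?filter_uniq ?fset_uniq // => V V'.
  rewrite !mem_filter !in_fset_set // => /andP[/eqP e1 /set_mem/fiber_carrier c1].
  move=> /andP[/eqP e2 /set_mem/fiber_carrier c2] [ek eT].
  by apply: inj; rewrite ?inE // /vst_iso e1 e2 ek eT.
- by apply: allpairs_uniq; rewrite ?iota_uniq ?fset_uniq // => -[? ?] [? ?] _ _ [-> ->].
move=> [k T]; apply/mapP/allpairsP.
  move=> [V]; rewrite mem_filter in_fset_set // => /andP[/eqP e /set_mem AV] [-> ->].
  have cV := fiber_carrier AV; exists (vidx n lam V, vssyt n lam V); split=> //=.
    by rewrite mem_iota /= add0n -e /hw_mult index_mem; apply: vtop_mem.
  rewrite in_fset_set // inE; have [[sT _] _] := vssytP plam cV; rewrite e in sT.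
  split=> //; case: AV => _ <-; exact: (vst_iso_wt plam cV).
move=> [[k' T'] /= [kh + [-> ->]]]; rewrite in_fset_set // => /set_mem[sT eT].
have cY : @carrier (crystal_sum (subpartitions lam)
    (fun mu => crystal_copies (hw_mult n lam mu) (Bcrystal n mu))) (triple n lam mu k' T').
  split=> //; split=> /=; first by move: kh; rewrite mem_iota.
  by split=> //; apply: content_bounded => l /mn; rewrite eT.
have [V cV eV] := surj _ cY.
have em : vmu n lam V = mu by have := congr1 (fun x => projT1 x) eV.
exists V; last first.
  have -> : k' = vidx n lam V by have := congr1 (fun x => projT1 (projT2 x)) eV.
  have -> // : T' = vssyt n lam V.
  by have := congr1 (fun x => projT2 (projT2 x) : seq (seq nat)) eV.
rewrite mem_filter em eqxx /= in_fset_set // inE; split; first by case: cV.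
by rewrite -eT -(vst_iso_wt plam cV) eV.
Qed.

Import GRing.Theory.
Local Open Scope ring_scope.

Lemma gbar_expansion : gbar lam m =
  \sum_(mu \in subpartitions lam)
     'X^(sumn lam - sumn mu) * (hw_mult n lam mu)%:R * schur mu m.
Proof.
have finA : finite_set A by apply: finite_vst_wt.
have finS := finite_subpartitions lam.
rewrite /gbar !fsbig_finite //.
(* Each [V] is filed under its own [vmu]; exchanging the sums then counts by [mu]. *)
transitivity (\sum_(V <- fset_set A) \sum_(mu <- fset_set (subpartitions lam) | vmu n lam V == mu)
   ('X^(sumn lam - sumn mu) : {poly int})).
  apply: eq_big_seq => V; rewrite in_fset_set // => /set_mem/fiber_carrier cV.
  rewrite (size_vst_ssyt plam cV) big_mkcond (bigD1_seq (vmu n lam V)) ?fset_uniq //=.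
    by rewrite eqxx big1 ?addr0 // => mu; rewrite eq_sym => /negbTE ->.
  by rewrite in_fset_set // inE; have [] := vmuP plam cV.
rewrite (exchange_big_dep predT) //=; apply: eq_big_seq => mu.
rewrite in_fset_set // => /set_mem smu.
rewrite big_const_seq iter_addr_0 (fiber_card smu) /schur fsbig_finite; last first.
  exact: finite_ssyt_content.
by rewrite big_const_seq iter_addr_0 count_predT -mulrA -natrM mulr_natr.
Qed.

End Fiber.

(** Row [r] of a highest weight element holds only [r.+1], so its entries are at most the length of
    [lam], whatever the bound [n]. *)
Lemma hw_elements_stable N n lam mu : is_partition lam -> size lam <= N -> N <= n ->
  hw_elements n lam mu = hw_elements N lam mu.
Proof.
move=> plam sN Nn; apply/seteqP; split=> V [vV le hw wV].
  have hwV := (highest_weightP plam (conj vV le)).1 hw.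
  have ent := hw_entry plam vV le hwV.
  split=> //; last by move=> i /andP[i0 iN]; apply: hw; rewrite i0 (leq_trans iN).
  move=> r c; have [cl|cl] := ltnP c (nth 0 lam r); last by rewrite cell_out ?(vst_shape1 vV).
  rewrite ent // (leq_trans _ sN) // ltnNge; apply/negP => h.
  by rewrite nth_default in cl.
have hwV := (highest_weightP plam (conj vV le)).1 hw.
have le' : entries_le n V.1 by move=> r c; apply: leq_trans (le r c) Nn.
split=> //; apply/(highest_weightP plam (conj vV le')) => i /andP[i0 _].
have [iN|Ni] := ltnP i N; first by apply: hwV; rewrite i0.
by apply: eps_notin; apply/negP => /(rd_letters plam vV le); lia.
Qed.

Import GRing.Theory.
Local Open Scope ring_scope.

Lemma gbar_expansion_stable N lam m : is_partition lam -> (size lam <= N)%N -> gbar lam m =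
  \sum_(mu \in subpartitions lam)
     'X^(sumn lam - sumn mu) * (hw_mult N lam mu)%:R * schur mu m.
Proof.
move=> plam sN.
(* If [m] has infinite support both sides are 0, since a tableau has finitely many letters.
   Otherwise [maxn n0 N] bounds the support and lies in the range where the multiplicities are
   stable. *)
have [[n0 hn0]|nb] := pselect (exists n0, forall k, (n0 <= k)%N -> m k = 0%N).
  rewrite (@gbar_expansion (maxn n0 N)) //; last by move=> k; rewrite geq_max => /andP[/hn0].
  by rewrite /hw_mult; under eq_fsbigr do rewrite (hw_elements_stable _ plam sN (leq_maxr n0 N)).
rewrite /gbar fsbig1 => [|V [vV eV]].
  rewrite fsbig1 // => mu _; rewrite /schur fsbig1 ?mulr0 // => T [sT eT].
  exfalso; apply: nb; exists (\max_(x <- flatten T) x) => k hk; rewrite -eT.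
  apply/count_memPn/negP => h.
  by have := @leq_bigmax_seq _ _ xpredT id _ h isT; rewrite leqNgt ltnS hk.
exfalso; apply: nb; exists (\max_(x <- flatten V.1) x) => k hk; rewrite -eV vst_wtE.
apply/count_memPn/negP => /(rd_letters plam vV (entry_le_max V.1)).
by rewrite /= ltnNge hk.
Qed.

Theorem theorem5p6 (n : nat) (lam : seq nat)
    (hn : (2 <= n)%N) (hlam : is_partition lam) :
  [/\ crystal_iso n (VST n lam)
        (crystal_sum (subpartitions lam)
           (fun mu => crystal_copies (hw_mult n lam mu) (Bcrystal n mu))),
      (* in the variables x_1, ..., x_n *)
      (forall m : nat -> nat, (forall k, (n <= k)%N -> m k = 0%N) ->
         gbar lam m =
         \sum_(mu \in subpartitions lam)
           'X^(sumn lam - sumn mu) * (hw_mult n lam mu)%:R * schur mu m) &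
      (* in infinitely many variables, where V_lam^mu is counted in VST^N(lam)
         for any N at least the length of lam *)
      (forall N : nat, (size lam <= N)%N -> forall m : nat -> nat,
         gbar lam m =
         \sum_(mu \in subpartitions lam)
           'X^(sumn lam - sumn mu) * (hw_mult N lam mu)%:R * schur mu m)].
Proof.
split.
- exact: vst_crystal_iso.
- by move=> m mn; apply: gbar_expansion.
by move=> N sN m; apply: gbar_expansion_stable.
Qed.
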